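(* Let $(X,T)$ and $(Y,S)$ be shifts, where $(X,T)$ is a transitive shift of finite type. Then for every $f\in C(X\times Y)$ the functional $\psi_f:\mathcal{M}_S(Y)\to\mathbb{R}$ is continuous and affine. In particular, there exists an ergodic $\nu_0\in\partial_e\mathcal{M}_S(Y)$ which is $\alpha$-maximizing, i.e. $\psi_f(\nu_0)=\sup_{\nu\in\mathcal{M}_S(Y)}\psi_f(\nu)$.
   Context: For a finite alphabet $\mathcal{A}$ (discrete), $\mathcal{A}^{\mathbb{Z}}$ carries the product topology and left shift $(Tx)(j)=x(j+1)$. A shift is a nonempty compact $X\subseteq\mathcal{A}^{\mathbb{Z}}$ with $TX=X$; it is a shift of finite type if for some $M\in\mathbb{N}$ and $\mathcal{F}\subseteq\mathcal{A}^{\{0,\dots,M\}}$, $X=\{x:(T^jx)|_{[0,M]}\notin\mathcal{F}\ \forall j\in\mathbb{Z}\}$. A shift $X$ is transitive if there is $D\in\mathbb{N}$ such that for all $x_1,x_2\in X$ and integers $b_1,a_2$ with $a_2-b_1\ge D$ there is $x'\in X$ with $x'(j)=x_1(j)$ for $j\le b_1$ and $x'(j)=x_2(j)$ for $j\ge a_2$. $\mathcal{M}_S(Y)$ is the set of $S$-invariant Borel probability measures with the weak* topology, $\partial_e$ its extreme (ergodic) points. With $\pi_Y(x,y)=y$, $\psi_f(\nu)=\min\{\int f\,d\lambda:\lambda\in\mathcal{M}_{T\times S}(X\times Y),(\pi_Y)_*\lambda=\nu\}$ and $\alpha(f)=\sup_\nu\psi_f(\nu)$. *)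

(* Defs.v *)
From HB Require Import structures.
From mathcomp Require Import all_boot all_order all_algebra.
From mathcomp Require Import all_classical all_reals all_analysis.
Import Order.TTheory GRing.Theory Num.Theory numFieldNormedType.Exports.
Set Implicit Arguments.
Unset Strict Implicit.
Unset Printing Implicit Defensive.
Local Open Scope classical_set_scope.
Local Open Scope ring_scope.

(* A finite (nonempty, pointed) alphabet.  The point is only needed so that  *)
(* MathComp-Analysis can build the Borel sigma-algebra; every shift is       *)
(* nonempty, so its alphabet is nonempty anyway.                             *)
#[short(type="pfinType")]
HB.structure Definition PointedFinite := {T of Finite T & isPointed T}.

Definition Conf (A : pfinType) := {ptws int -> discrete_topology A}.

Definition Borel (T : topologicalType) := g_sigma_algebraType (@open T).

Definition shift {A : pfinType} (x : Conf A) : Conf A := fun j => x (j + 1).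

Definition is_shift {A : pfinType} (X : set (Conf A)) : Prop :=
  X !=set0 /\ compact X /\ shift @` X = X.

Definition window {A : pfinType} (M : nat) (x : Conf A) (j : int)
  : {ffun 'I_M.+1 -> A} := [ffun k : 'I_M.+1 => x (j + (k : nat)%:Z)].

Definition is_SFT {A : pfinType} (X : set (Conf A)) : Prop :=
  is_shift X /\
  exists (M : nat) (F : {set {ffun 'I_M.+1 -> A}}),
    X = [set x | forall j : int, window M x j \notin F].

(* Transitivity (in the specification sense of the paper). *)
Definition transitive_shift {A : pfinType} (X : set (Conf A)) : Prop :=
  exists D : nat, forall x1 x2 : Conf A, X x1 -> X x2 ->
    forall b1 a2 : int, (D%:Z <= a2 - b1) ->
      exists x' : Conf A, X x' /\
        (forall j : int, j <= b1 -> x' j = x1 j) /\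
        (forall j : int, a2 <= j -> x' j = x2 j).

Definition invariant (R : realType) d (T : measurableType d) (phi : T -> T)
  (mu : set T -> \bar R) : Prop :=
  forall E : set T, measurable E -> mu (phi @^-1` E) = mu E.

(* M_S(Y): S-invariant Borel probability measures on Y (= Borel probability *)
(* measures on B^Z giving full mass to Y).                                  *)
Definition MS (R : realType) (B : pfinType) (Y : set (Conf B))
  : set (probability (Borel (Conf B)) R) :=
  [set nu | nu Y = 1%E /\ invariant (@shift B : Borel (Conf B) -> Borel (Conf B)) nu].

Definition shift2 {A B : pfinType} (z : Conf A * Conf B) : Conf A * Conf B :=
  (shift z.1, shift z.2).

Definition couplings (R : realType) (A B : pfinType) (X : set (Conf A))
  (Y : set (Conf B)) (nu : probability (Borel (Conf B)) R)
  : set (probability (Borel (Conf A * Conf B)%type) R) :=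
  [set l | l (X `*` Y) = 1%E /\
           invariant (@shift2 A B : Borel (Conf A * Conf B)%type -> _) l /\
           (forall E : set (Borel (Conf B)), measurable E ->
              l (snd @^-1` E) = nu E)].

(* psi_f(nu) = inf { int_{X x Y} f dlambda : lambda coupling }, as an       *)
(* extended real (the paper asserts the inf is a min and finite).           *)
Definition psiE (R : realType) (A B : pfinType) (X : set (Conf A))
  (Y : set (Conf B)) (f : Conf A * Conf B -> R)
  (nu : probability (Borel (Conf B)) R) : \bar R :=
  ereal_inf [set (\int[l]_(z in X `*` Y) (f z)%:E)%E | l in couplings X Y nu].

Definition psi (R : realType) (A B : pfinType) (X : set (Conf A))
  (Y : set (Conf B)) (f : Conf A * Conf B -> R)
  (nu : probability (Borel (Conf B)) R) : R := fine (psiE X Y f nu).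

Definition cont_on (R : realType) (B : pfinType) (Y : set (Conf B))
  (g : Conf B -> R) : Prop := {within Y, continuous g}.

Definition intY (R : realType) (B : pfinType) (Y : set (Conf B))
  (nu : probability (Borel (Conf B)) R) (g : Conf B -> R) : R :=
  fine (\int[nu]_(y in Y) (g y)%:E)%E.

(* Continuity of Psi on M (subset of Borel prob. measures on Y) for the    *)
(* weak* topology, i.e. the topology generated by nu |-> int_Y g dnu,      *)
(* g in C(Y): every nu in M has a basic weak* neighbourhood mapped into    *)
(* the eps-ball around Psi nu.                                             *)
Definition weak_star_continuous_on (R : realType) (B : pfinType)
  (Y : set (Conf B)) (M : set (probability (Borel (Conf B)) R))
  (Psi : probability (Borel (Conf B)) R -> R) : Prop :=
  forall nu, M nu -> forall eps : R, 0 < eps ->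
    exists (n : nat) (g : 'I_n -> Conf B -> R) (delta : R),
      0 < delta /\ (forall i, cont_on Y (g i)) /\
      forall nu', M nu' ->
        (forall i, `|intY Y nu' (g i) - intY Y nu (g i)| < delta) ->
        `|Psi nu' - Psi nu| < eps.

Definition mixture (R : realType) d (T : measurableType d)
  (nu nu1 nu2 : set T -> \bar R) (t : R) : Prop :=
  forall E : set T, measurable E -> nu E = (t%:E * nu1 E + (1 - t)%:E * nu2 E)%E.

Definition affine_on (R : realType) d (T : measurableType d)
  (M : set (probability T R)) (Psi : probability T R -> R) : Prop :=
  forall (nu nu1 nu2 : probability T R) (t : R), M nu -> M nu1 -> M nu2 ->
    0 <= t <= 1 -> mixture nu nu1 nu2 t ->
    Psi nu = t * Psi nu1 + (1 - t) * Psi nu2.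

Definition extreme_point (R : realType) d (T : measurableType d)
  (M : set (probability T R)) (nu : probability T R) : Prop :=
  M nu /\
  forall (nu1 nu2 : probability T R) (t : R), M nu1 -> M nu2 ->
    0 < t < 1 -> mixture nu nu1 nu2 t ->
    forall E : set T, measurable E -> nu1 E = nu2 E.

(* Main.v *)
(* For a locally constant h on the product space, let g_n(y) be the infimum    *)
(* over x in X of the Birkhoff sum of h along the first n points of the orbit  *)
(* of (x, y).  Then g is superadditive along the shift, and the glueing        *)
(* property of X makes it subadditive up to an additive constant C.  Hence,    *)
(* with a_n(nu) the integral of g_n against nu, a_N(nu)/N <= (a_n(nu) + C)/n   *)
(* for all n and N.  Any coupling l of nu satisfies a_n(nu)/n <= l(h), and the *)
(* Krylov-Bogolyubov averages along orbits of near-minimizers y |-> (x_n(y),y) *)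
(* produce a coupling with l(h) <= (a_n(nu) + C)/n.  So psi_h is within C/n of *)
(* nu |-> a_n(nu)/n, and psi_f is a uniform limit of integrals of locally      *)
(* constant functions; continuity and affinity follow.                         *)
(*                                                                             *)
(* Limit measures are obtained without Riesz representation: the ultralimit of *)
(* the values on clopen sets is a content, which by compactness is a           *)
(* premeasure and extends to the Borel sets.                                   *)
(*                                                                             *)
(* An extreme maximizer arises by maximizing lexicographically psi_f and then  *)
(* nu(C_0), nu(C_1), ..., where the C_k enumerate the clopen sets: the         *)
(* resulting set of measures is a face, and a single point.                    *)
Require Import Defs.
From HB Require Import structures.
From mathcomp Require Import all_boot all_order all_algebra.
From mathcomp Require Import all_classical all_reals all_analysis measurable_realfun.
From mathcomp Require Import ring lra zify.
Import Order.TTheory GRing.Theory Num.Theory numFieldNormedType.Exports.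
Local Open Scope classical_set_scope.
Local Open Scope ring_scope.
Set Implicit Arguments.
Unset Strict Implicit.
Unset Printing Implicit Defensive.
(* MathComp has its own [shift] and [invariant]. *)
Local Notation shift := Defs.shift.
Local Notation invariant := Defs.invariant.

(** * Borel probabilities from contents on clopen sets *)

(** Minimizing over couplings reduces, with an error uniform in [nu], to minimizing fiber by fiber
    over blocks of a fixed length. For locally constant [h], a coupling cannot beat the fiberwise
    infimum on blocks, because its projection is [nu] ([coupling_mean_ge]). Conversely, transitivity
    lets near-optimal blocks be concatenated at a cost independent of their lengths
    ([fiber_min_subadditive]), so the means of the infima are almost additive
    ([mean_fiber_min_slope]), and a limit of orbit averages of near-minimizers ([krylov_bogolyubov])
    is a coupling within [C / n] of the value for blocks of length [n] ([coupling_exists]).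

    Taking [n] large makes [psi] a uniform limit on [MS Y] of continuous affine functionals
    ([psi_approximation]). Its maximum is attained on a nonempty closed face of the compact convex
    set [MS Y]; maximizing the measures of the clopen sets in turn cuts this face down to one point,
    which is extreme ([approximable_extreme_max]). *)

Definition stone_space (Z : topologicalType) : Prop :=
  [/\ compact [set: Z],
      forall (z : Z) U, nbhs z U -> exists C, [/\ clopen C, C z & C `<=` U] &
      exists e : nat -> set Z, (forall k, clopen (e k)) /\
        forall C, clopen C -> exists k, C = e k].

(* An alias carrying the clopen sets as measurable sets, so that the          *)
(* Caratheodory extension applies to contents defined on clopen sets only.    *)
Definition clopen_sets (Z : Type) := Z.

Section clopen_algebra.
Variable Z : ptopologicalType.

HB.instance Definition _ := Pointed.on (clopen_sets Z).
HB.instance Definition _ := @isAlgebraOfSets.Build default_measure_display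
  (clopen_sets Z) (@clopen Z) clopen0 clopenU (fun A => @clopenC Z A A).

End clopen_algebra.

(** [mu] is a bare measure of mass one so that the Caratheodory extension can be plugged in. *)
Lemma pushforward_probability (R : realType) d d' (T : measurableType d)
    (T' : measurableType d') (mu : {measure set T -> \bar R}) (f : T -> T') :
  measurable_fun setT f -> mu setT = 1%E ->
  exists P : probability T' R, forall A, P A = mu (f @^-1` A).
Proof.
move=> mf mu1; 
have [M ME] : exists M : {measure set T' -> \bar R},
    forall A, M A = mu (f @^-1` A).
  by unshelve refine (ex_intro _ (pushforward mu f : {measure set T' -> \bar R}) _).
have M1 : M setT = 1%E by rewrite ME preimage_setT.
pose M' : set T' -> \bar R := M.
pose mM := isMeasure.Build _ _ _ M' (measure0 M) (measure_ge0 M)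
  (@measure_semi_sigma_additive _ _ _ M).
pose N : {measure set T' -> \bar R} := HB.pack M' mM.
pose P : probability T' R := HB.pack M' mM
  (Measure_isProbability.Build d' T' R N M1).
by exists P.
Qed.

Section borel_of_clopen.
Variables (R : realType) (Z : ptopologicalType).
Hypothesis stZ : stone_space Z.

(** The clopen sets form a countable basis; those in the list [e] that do not lie inside [U] are
    replaced by the empty set. *)
Lemma open_bigcup_clopen (U : set Z) : open U ->
  exists2 C : nat -> set Z, (forall n, clopen (C n)) & U = \bigcup_n C n.
Proof.
move=> oU; have [_ base [e [ce eE]]] := stZ.
exists (fun k => if `[< e k `<=` U >] then e k else set0).
  by move=> n; case: asboolP => // _; exact: clopen0.
apply/seteqP; split=> [z Uz|z [k _]]; last by case: asboolP => // ekU /ekU.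
have [C [cC Cz CU]] := base z U (open_nbhs_nbhs (conj oU Uz)).
have [k Ck] := eE C cC; exists k => //.
by rewrite -Ck; case: asboolP.
Qed.

Lemma measurable_clopen (C : set (Borel Z)) : clopen (C : set Z) -> measurable C.
Proof. by move=> [oC _]; exact: sub_sigma_algebra. Qed.

Lemma measurable_open (C : set (Borel Z)) : open (C : set Z) -> measurable C.
Proof. by move=> oC; exact: sub_sigma_algebra. Qed.

Lemma measurable_closed (C : set (Borel Z)) : closed (C : set Z) -> measurable C.
Proof.
move=> cC; rewrite -(setCK C); apply: measurableC; apply: measurable_open.
exact: closed_openC.
Qed.

Lemma borel_clopenE :
  (measurable : set (set (Borel Z))) = <<s [set C : set Z | clopen C] >>.
Proof.
apply/seteqP; split; apply: smallest_sub.
- exact: smallest_sigma_algebra.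
- move=> U /open_bigcup_clopen[C cC ->].
  by apply: (@sigma_algebra_bigcup _ setT) => n; apply: sub_sigma_algebra; exact: cC.
- exact: sigma_algebra_measurable.
- by move=> C [oC _]; exact: sub_sigma_algebra.
Qed.

(** The clopen sets are a pi-system that generates the Borel sets. *)
Lemma eq_probability (P Q : {measure set (Borel Z) -> \bar R}) :
  P setT = 1%E ->
  (forall C : set Z, clopen C -> P C = Q C) ->
  forall E : set (Borel Z), measurable E -> P E = Q E.
Proof.
move=> P1 PQ E mE.
apply: (@measure_unique _ R (Borel Z) [set C : set Z | clopen C] (fun=> setT)) => //.
- exact: borel_clopenE.
- by move=> A B; exact: clopenI.
- by move=> _; exact: clopenT.
- by apply/seteqP; split => // z _; exists 0%N.
- by move=> _; rewrite P1 ltry.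
Qed.

Section content.
Variable m : set Z -> R.
Hypotheses (m_ge0 : forall C, clopen C -> 0 <= m C) (mT : m setT = 1).
Hypothesis mU : forall C D, clopen C -> clopen D -> C `&` D = set0 ->
  m (C `|` D) = m C + m D.

Let m0 : m set0 = 0.
Proof.
have := mU clopen0 clopen0 (setI0 _); rewrite setU0 => m00.
by apply: (addrI (m set0)); rewrite addr0.
Qed.

(** The default 0 makes nonnegativity hold for every set, as the content structure demands. *)
Definition clopen_content (C : set (clopen_sets Z)) : \bar R :=
  if `[< clopen (C : set Z) >] then (m C)%:E else 0%E.

Let mE C : clopen (C : set Z) -> clopen_content C = (m C)%:E.
Proof. by rewrite /clopen_content; case: asboolP. Qed.

Let mc_ge0 C : (0 <= clopen_content C)%E.
Proof.
by rewrite /clopen_content; case: asboolP => // cC; rewrite lee_fin m_ge0.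
Qed.

Let mc_semi_additive : measure_function.semi_additive clopen_content.
Proof.
apply/additive2P; first by rewrite mE ?m0//; exact: clopen0.
move=> A B cA cB AB; rewrite !mE ?mU//; exact: clopenU.
Qed.

HB.instance Definition _ := isContent.Build _ _ _ clopen_content
  mc_ge0 mc_semi_additive.

(* By compactness a clopen set covered by countably many clopen sets is *)
(* covered by finitely many of them.                                    *)
Let mc_sigma_subadditive : measurable_subset_sigma_subadditive clopen_content.
Proof.
move=> A F cF cA AF.
have [cZ _ _] := stZ.
have : cover_compact (A : set Z).
  by rewrite -compact_cover; apply: (subclosed_compact _ cZ) => //; case: cA.
move=> /(_ nat setT (F : nat -> set Z)) [n _|z /AF[n _ Fz]|D _ AD].
- by have [] := cF n.
- by exists n.
pose N := (\max_(i <- finmap.enum_fset D) i).+1.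
have AN : A `<=` \big[setU/set0]_(n < N) F n.
  move=> z /AD [i /= iD Fiz]; rewrite -bigcup_mkord; exists i => //=.
  by rewrite ltnS; apply: leq_bigmax_seq.
have := @content_subadditive _ _ _ clopen_content A F N (fun i _ => cF i) cA AN.
move=> /le_trans; apply.
rewrite -(big_mkord xpredT (clopen_content \o F)).
by apply: nneseries_lim_ge => i _ _; exact: mc_ge0.
Qed.

HB.instance Definition _ := Content_SigmaSubAdditive_isMeasure.Build _ _ _
  clopen_content mc_sigma_subadditive.

(** The Caratheodory extension lives on the sigma-algebra generated by the clopen sets. This is the
    Borel one by [borel_clopenE], so the identity transports the measure. *)
Lemma probability_of_content :
  exists P : probability (Borel Z) R, forall C : set Z, clopen C -> P C = (m C)%:E.
Proof.
pose G := g_sigma_algebraType (@measurable _ (clopen_sets Z)).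
have mid : measurable_fun setT (id : G -> Borel Z).
  move=> _ Y mY; rewrite setTI preimage_id.
  by move: mY; rewrite borel_clopenE.
pose mu : {measure set G -> \bar R} := measure_extension clopen_content.
have muE C : clopen (C : set Z) -> mu C = (m C)%:E.
  move=> cC; rewrite /mu /=.
  have := @measurable_mu_extE _ _ _ clopen_content C cC.
  by rewrite /= mE.
have [|P PE] := pushforward_probability (mu := mu) mid.
  by rewrite muE ?mT//; exact: clopenT.
by exists P => C cC; rewrite PE preimage_id muE.
Qed.

End content.
End borel_of_clopen.

(** * Locally constant functions *)

(** The codomain is a bare type, so that maps with values in sets, such as [agr n], are covered. *)
Definition loc_const (Z : topologicalType) (S : Type) (h : Z -> S) :=
  forall z, \forall z' \near z, h z' = h z.

Section loc_const_theory.
Variable Z : ptopologicalType.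

Lemma loc_const_open S (h : Z -> S) (A : set S) : loc_const h -> open (h @^-1` A).
Proof.
move=> lh; rewrite openE => z /= Az; rewrite /interior.
by apply: filterS (lh z) => z' /= ->.
Qed.

Lemma loc_const_clopen S (h : Z -> S) (A : set S) : loc_const h -> clopen (h @^-1` A).
Proof.
move=> lh; split; first by move: lh; exact: loc_const_open.
have : open (h @^-1` (~` A)) by exact: loc_const_open.
by move/open_closedC; rewrite -preimage_setC setCK.
Qed.

Lemma loc_const_comp (Z' : topologicalType) S (t : Z -> Z') (h : Z' -> S) :
  continuous t -> loc_const h -> loc_const (h \o t).
Proof. by move=> ct lh z; exact: (ct z _ (lh (t z))). Qed.

Lemma loc_const_cst S (s : S) : loc_const (fun _ : Z => s).
Proof. by move=> z; exact: nearW. Qed.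

Lemma loc_const_fun1 S S' (F : S -> S') (h : Z -> S) :
  loc_const h -> loc_const (F \o h).
Proof. by move=> lh z; apply: filterS (lh z) => z' /= ->. Qed.

Lemma loc_const_fun2 S1 S2 S' (F : S1 -> S2 -> S') (h : Z -> S1) (k : Z -> S2) :
  loc_const h -> loc_const k -> loc_const (fun z => F (h z) (k z)).
Proof. by move=> lh lk z; apply: filterS2 (lh z) (lk z) => z' -> ->. Qed.

Lemma loc_const_indic (R : realType) (C : set Z) : clopen C -> loc_const (\1_C : Z -> R).
Proof.
move=> [oC cC] z; have [Cz|Cz] := pselect (C z).
  apply: filterS (open_nbhs_nbhs (conj oC Cz)) => z' Cz'.
  by rewrite !indicE !mem_set.
apply: filterS (open_nbhs_nbhs (conj (closed_openC cC) Cz)) => z' Cz'.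
by rewrite !indicE !memNset.
Qed.

Lemma loc_const_finite (S : choiceType) (h : Z -> S) : compact [set: Z] -> loc_const h ->
  exists2 D : seq S, uniq D & forall z, h z \in D.
Proof.
move=> cptZ lh; have : cover_compact [set: Z] by rewrite -compact_cover.
move=> cZ; have [r _|z _|D _ DZ] := cZ S setT (fun r => h @^-1` [set r]).
- by move: lh; exact: loc_const_open.
- by exists (h z).
- exists (finmap.enum_fset D) => [|z]; first exact: finmap.fset_uniq.
  by have [r /= rD ->] := DZ z I.
Qed.

Lemma loc_const_bounded (R : realType) (h : Z -> R) : compact [set: Z] -> loc_const h ->
  exists M, forall z, `|h z| <= M.
Proof.
move=> cZ lh; have [D _ hD] := loc_const_finite cZ lh.
exists (\sum_(r <- D) `|r|) => z.
by rewrite (big_rem (h z)) //= lerDl sumr_ge0.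
Qed.

End loc_const_theory.

Section loc_const_integral.
Variables (R : realType) (Z : ptopologicalType).
Hypothesis cZ : compact [set: Z].
Implicit Types (h k : Z -> R) (P : probability (Borel Z) R).

Lemma loc_const_measurable h : loc_const h ->
  measurable_fun setT (h : Borel Z -> R).
Proof.
move=> lh _ Y _; rewrite setTI; apply: measurable_open.
exact: loc_const_open.
Qed.

Lemma loc_const_integrable P h : loc_const h -> P.-integrable setT (EFin \o h).
Proof.
move=> lh; apply: measurable_bounded_integrable => //.
- by rewrite [ltLHS](probability_setT P) ltry.
- exact: loc_const_measurable.
- have [M hM] := loc_const_bounded cZ lh.
  by exists M; split; [exact: num_real|move=> N MN z _ /=; exact: le_trans (ltW MN)].
Qed.

Lemma Rintegral_indicT P (C : set Z) : clopen C ->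
  \int[P]_(z in setT) (\1_C z : R) = fine (P C).
Proof.
by move=> cC; rewrite /Rintegral integral_indic ?setIT//; exact: measurable_clopen.
Qed.

(** [D] may contain values that [h] does not take, so one list serves [h] and its composites with
    other maps. *)
Lemma Rintegral_loc_const P h (D : seq R) : loc_const h -> uniq D ->
  (forall z, h z \in D) ->
  \int[P]_(z in setT) h z = \sum_(r <- D) r * fine (P (h @^-1` [set r])).
Proof.
move=> lh uD hD.
have cl r : clopen (h @^-1` [set r]) by exact: loc_const_clopen.
have hE z : h z = \sum_(r <- D) r * \1_(h @^-1` [set r]) z.
  rewrite (big_rem (h z)) //= indicE mem_set // mulr1 big1_seq ?addr0// => r /=.
  rewrite rem_filter // mem_filter /= => /andP[rh _].
  by rewrite indicE memNset ?mulr0// => /= hr; rewrite hr eqxx in rh.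
under eq_Rintegral do rewrite hE.
elim: D {uD hD hE} => [|r D IH].
  under eq_Rintegral do rewrite big_nil.
  by rewrite Rintegral_cst// mul0r big_nil.
under eq_Rintegral do rewrite big_cons.
have li : loc_const (fun z => r * \1_(h @^-1` [set r]) z).
  exact: (loc_const_fun1 (fun x => r * x) (loc_const_indic R (cl r))).
have ls (s : seq R) : loc_const (fun z => \sum_(r <- s) r * \1_(h @^-1` [set r]) z).
  elim: s => [|x s IHs] z; first by apply: nearW => z'; rewrite !big_nil.
  have lx := loc_const_fun1 (fun y => x * y) (loc_const_indic R (cl x)).
  by apply: filterS2 (lx z) (IHs z) => z' /= e1 e2; rewrite !big_cons e1 e2.
rewrite RintegralD//; last 2 first.
- exact: (loc_const_integrable P li).
- exact: (loc_const_integrable P (ls D)).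
rewrite IH big_cons RintegralZl// ?Rintegral_indicT//.
exact: (loc_const_integrable P (loc_const_indic R (cl r))).
Qed.

Lemma le_Rintegral_loc_const P h k : loc_const h -> loc_const k ->
  (forall z, h z <= k z) ->
  \int[P]_(z in setT) h z <= \int[P]_(z in setT) k z.
Proof. by move=> lh lk hk; apply: le_Rintegral => //; exact: loc_const_integrable. Qed.

Lemma Rintegral_loc_constD P h k : loc_const h -> loc_const k ->
  \int[P]_(z in setT) (h z + k z) =
  \int[P]_(z in setT) h z + \int[P]_(z in setT) k z.
Proof. by move=> lh lk; apply: RintegralD => //; exact: loc_const_integrable. Qed.

Lemma Rintegral_prob_cst P (r : R) : \int[P]_(z in setT) r = r.
Proof. rewrite Rintegral_cst//; have := probability_setT P.
by move=> /= ->; rewrite mulr1. Qed.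

Lemma Rintegral_loc_const_norm P h M : loc_const h -> (forall z, `|h z| <= M) ->
  `|\int[P]_(z in setT) h z| <= M.
Proof.
move=> lh hM.
have lc (r : R) := @loc_const_cst Z R r.
rewrite ler_norml -[X in - X <= _](Rintegral_prob_cst P).
rewrite -[X in _ && (_ <= X)](Rintegral_prob_cst P).
rewrite -[X in X <= _]mulN1r -RintegralZl//; last exact: loc_const_integrable.
by apply/andP; split; apply: le_Rintegral_loc_const => // z;
  have := hM z; rewrite ler_norml ?mulN1r => /andP[].
Qed.

End loc_const_integral.

Lemma Rintegral_loc_const_comp (R : realType) (Z Z' : ptopologicalType)
    (P : probability (Borel Z) R) (Q : probability (Borel Z') R)
    (t : Z -> Z') (h : Z' -> R) :
  compact [set: Z] -> compact [set: Z'] ->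
  (forall C : set Z', clopen C -> P (t @^-1` C) = Q C) ->
  loc_const h -> loc_const (h \o t) ->
  \int[P]_(z in setT) h (t z) = \int[Q]_(z in setT) h z.
Proof.
move=> cZ cZ' PQ lh lht; have [D uD hD] := loc_const_finite cZ' lh.
rewrite (Rintegral_loc_const cZ' Q lh uD hD).
rewrite (@Rintegral_loc_const R Z cZ P (h \o t) D lht uD); last by move=> z; exact: hD.
by apply: eq_bigr => r _; rewrite -PQ//; exact: loc_const_clopen.
Qed.

(** * Ultralimits and invariant measures *)

Section ultralimit.
Variables (R : realType) (U : set_system nat).
Hypotheses (UF : UltraFilter U) (ooU : \oo `<=` U).

(** By compactness of the segment the image filter clusters at some [p], and an ultrafilter
    converges to each of its cluster points. *)
Lemma ultra_bounded_cvg (u : nat -> R) (M : R) :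
  (forall n, `|u n| <= M) -> cvg (u n @[n --> U]).
Proof.
move=> uM.
have cM : compact (`[- M, M]%classic : set R) by exact: segment_compact.
have FM : (u n @[n --> U]) `[- M, M]%classic.
  by rewrite /nbhs /=; apply: filterE => n /=; rewrite in_itv /= -ler_norml.
have [p [_ clp]] := cM _ _ FM.
apply/cvg_ex; exists p => V Vp.
have [//|UnV] := in_ultra_setVsetC (u @^-1` V) UF.
have [x [nVx Vx]] := clp (~` V) V UnV Vp.
by case: (nVx).
Qed.

Lemma ultra_invS (c : R) : c / n.+1%:R @[n --> U] --> (0 : R).
Proof.
have : c / n.+1%:R @[n --> \oo] --> (0 : R).
  by rewrite -[X in _ --> X](mulr0 c); apply: cvgMl_tmp; exact: cvg_harmonic.
by apply: cvg_trans => V /ooU.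
Qed.

Lemma ultra_lim_eq (u v : nat -> R) (c a b : R) :
  (forall n, `|u n - v n| <= c / n.+1%:R) ->
  u n @[n --> U] --> a -> v n @[n --> U] --> b -> a = b.
Proof.
move=> uv ua vb; apply/eqP; rewrite -subr_eq0; apply/eqP.
have w0 : u n - v n @[n --> U] --> (0 : R).
  apply: (@squeeze_cvgr _ _ _ _ (fun n => - (c / n.+1%:R)) (fun n => c / n.+1%:R)) => //.
  - by apply: nearW => n; rewrite -ler_norml.
  - by rewrite -[X in _ --> X]oppr0; apply: cvgN; exact: ultra_invS.
  - exact: ultra_invS.
exact: (cvg_unique _ (cvgB ua vb) w0).
Qed.

End ultralimit.

Lemma continuous_iter (Z : topologicalType) (t : Z -> Z) n :
  continuous t -> continuous (iter n t).
Proof.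
move=> ct; elim: n => [|n IH] z; first exact: cvg_id.
have c2 := @ct (iter n t z).
exact: (cvg_comp _ _ (IH z) c2).
Qed.

Lemma continuous_borel_measurable (Z Z' : ptopologicalType) (t : Z -> Z') :
  continuous t -> measurable_fun setT (t : Borel Z -> Borel Z').
Proof.
move=> ct; apply: (@measurability _ _ (Borel Z) (Borel Z') setT _ (@open Z')) => //.
move=> _ [Y oY <-].
by rewrite setTI; apply: measurable_open; exact: open_comp.
Qed.

Section krylov_bogolyubov.
Variables (R : realType) (Z : ptopologicalType) (U : set_system nat).
Hypotheses (stZ : stone_space Z) (UF : UltraFilter U) (ooU : \oo `<=` U).
Variables (tau : Z -> Z) (K : set Z) (mu : nat -> probability (Borel Z) R).
Hypotheses (ctau : continuous tau) (cK : closed K).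
Hypotheses (Ktau : forall z, K z -> K (tau z)) (muK : forall n, mu n K = 1%E).

Let cZ : compact [set: Z]. Proof. by case: stZ. Qed.

(** The integral of [h] against the average of the pushforwards of [mu n] by the first [n.+1]
    iterates of [tau], handled as a functional. *)
Definition empirical_mean n (h : Z -> R) : R :=
  n.+1%:R^-1 * \sum_(i < n.+1) \int[mu n]_(z in setT) h (iter i tau z).

Let lit h i : loc_const h -> loc_const (fun z => h (iter i tau z) : R).
Proof. by move=> lh; exact: (loc_const_comp (continuous_iter (n := i) ctau) lh). Qed.

Let mean_norm n h M : loc_const h -> (forall z, `|h z| <= M) ->
  `|empirical_mean n h| <= M.
Proof.
move=> lh hM; rewrite /empirical_mean normrM ger0_norm ?invr_ge0//.
rewrite ler_pdivrMl// mulrC -[leRHS]mulr1 -(mulrA M).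
apply: (le_trans (ler_norm_sum _ _ _)).
apply: (@le_trans _ _ (\sum_(i < n.+1) M)).
  by apply: ler_sum => i _; apply: (Rintegral_loc_const_norm cZ) => //; exact: lit.
by rewrite sumr_const card_ord mulr1 mulr_natr.
Qed.

Let meanD n h k : loc_const h -> loc_const k ->
  empirical_mean n (fun z => h z + k z) = empirical_mean n h + empirical_mean n k.
Proof.
move=> lh lk; rewrite /empirical_mean -mulrDr -big_split /=; congr (_ * _).
by apply: eq_bigr => i _; rewrite (Rintegral_loc_constD cZ)//; exact: lit.
Qed.

(** The difference of the two sums telescopes to two boundary terms, each at most [M] in absolute
    value. *)
Let mean_tau n h M : loc_const h -> (forall z, `|h z| <= M) ->
  `|empirical_mean n (h \o tau) - empirical_mean n h| <= (M + M) / n.+1%:R.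
Proof.
move=> lh hM; rewrite /empirical_mean -mulrBr normrM [leRHS]mulrC.
rewrite (ger0_norm (x := n.+1%:R^-1)) ?invr_ge0// ler_pM2l ?invr_gt0//.
pose J i := \int[mu n]_(z in setT) h (iter i tau z).
have JM i : `|J i| <= M by apply: (Rintegral_loc_const_norm cZ) => //; exact: lit.
rewrite (eq_bigr (fun i : 'I_n.+1 => J i.+1)); last first.
  by move=> i _; apply: eq_Rintegral => z _; rewrite /= -iterS iterSr.
rewrite -[X in _ - X]/(\sum_(i < n.+1) J i) -sumrB.
rewrite -(big_mkord xpredT (fun i => J i.+1 - J i)) telescope_sumr//.
by apply: (le_trans (ler_normB _ _)); exact: lerD.
Qed.

Let mean_rep n h (D : seq R) : loc_const h -> uniq D -> (forall z, h z \in D) ->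
  empirical_mean n h = \sum_(r <- D) r * empirical_mean n \1_(h @^-1` [set r]).
Proof.
move=> lh uD hD; rewrite /empirical_mean.
under [RHS]eq_bigr do rewrite mulrCA.
rewrite -mulr_sumr; congr (_ * _).
under [RHS]eq_bigr do rewrite mulr_sumr.
rewrite exchange_big /=; apply: eq_bigr => i _.
rewrite (@Rintegral_loc_const R Z cZ (mu n) (fun z => h (iter i tau z)) D (@lit h i lh) uD)//.
apply: eq_bigr => r _; congr (_ * _); rewrite -Rintegral_indicT//.
by apply: loc_const_clopen; exact: lit.
Qed.

(** Along an ultrafilter all bounded means converge at once, without extracting subsequences. The
    limits on clopen sets form a content, hence a Borel probability; [mean_tau] gives its
    invariance. *)
Lemma krylov_bogolyubov : exists P : probability (Borel Z) R,
  [/\ P K = 1%E, invariant (tau : Borel Z -> Borel Z) P &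
     forall h, loc_const h ->
       empirical_mean n h @[n --> U] --> \int[P]_(z in setT) h z].
Proof.
pose m (C : set Z) := lim (empirical_mean n \1_C @[n --> U]).
have ind_norm (C : set Z) z : `|\1_C z : R| <= 1.
  by rewrite indicE ger0_norm//; case: (_ \in _).
have cvm C : clopen C -> empirical_mean n \1_C @[n --> U] --> m C.
  move=> cC; apply: (@ultra_bounded_cvg _ _ _ _ 1) => n.
  by apply: mean_norm => //; exact: loc_const_indic.
have m_ge0 C : clopen C -> 0 <= m C.
  move=> cC; apply: limr_ge; first by apply/cvg_ex; exists (m C); exact: cvm.
  apply: nearW => n; apply: mulr_ge0; first by rewrite invr_ge0.
  by apply: sumr_ge0 => i _; apply: Rintegral_ge0.
have mT : m setT = 1.
  apply: cvg_lim => //; rewrite (_ : (fun n => _) = fun=> 1); first exact: cvg_cst.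
  apply/funext => n; rewrite /empirical_mean.
  rewrite (eq_bigr (fun=> 1)) ?sumr_const ?card_ord ?mulVf//.
  move=> i _; rewrite -[RHS](Rintegral_prob_cst (mu n)).
  by apply: eq_Rintegral => z _; rewrite indicT.
have mU C D : clopen C -> clopen D -> C `&` D = set0 -> m (C `|` D) = m C + m D.
  move=> cC cD CD; apply: cvg_lim => //.
  rewrite (_ : (fun n => _) = fun n => empirical_mean n \1_C + empirical_mean n \1_D).
    by apply: cvgD; exact: cvm.
  apply/funext => n; rewrite -meanD; try exact: loc_const_indic.
  congr empirical_mean; apply/funext => z; rewrite !indicE in_setU.
  have [/set_mem Cz|_] := boolP (z \in C); last by rewrite add0r.
  rewrite memNset ?addr0// => Dz.
  by have : (C `&` D) z by []; rewrite CD.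
have [P PE] := probability_of_content stZ m_ge0 mT mU.
have conv h : loc_const h -> empirical_mean n h @[n --> U] --> \int[P]_(z in setT) h z.
  move=> lh; have [D uD hD] := loc_const_finite cZ lh.
  rewrite (Rintegral_loc_const cZ P lh uD hD).
  rewrite (_ : (fun n => _) = fun n => \sum_(r <- D) r * empirical_mean n \1_(h @^-1` [set r])).
    elim: D {uD hD} => [|r D IH].
      rewrite (_ : (fun n => _) = fun=> 0); first by rewrite big_nil; exact: cvg_cst.
      by apply/funext => n; rewrite big_nil.
    rewrite (_ : (fun n => _) = fun n => r * empirical_mean n \1_(h @^-1` [set r]) +
      \sum_(r <- D) r * empirical_mean n \1_(h @^-1` [set r])); last first.
      by apply/funext => n; rewrite big_cons.
    rewrite big_cons; apply: cvgD IH; apply: cvgMl_tmp.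
    by rewrite PE; [apply: cvm|]; exact: loc_const_clopen.
  by apply/funext => n; exact: mean_rep.
exists P; split=> //; last first.
  have mtau := continuous_borel_measurable ctau.
  have [Q QE] := pushforward_probability mtau (probability_setT P).
  move=> E mE; rewrite -QE; apply: (eq_probability stZ) => //.
    exact: probability_setT.
  move=> C cC; transitivity (P (tau @^-1` C)); first exact: QE.
  have ctC : clopen (tau @^-1` C) by exact: preimage_clopen.
  rewrite [LHS]PE// [RHS]PE//; congr (_%:E).
  apply: (@ultra_lim_eq _ _ _ ooU (fun n => empirical_mean n (\1_C \o tau))
    (fun n => empirical_mean n \1_C) (1 + 1)).
  - by move=> n; apply: mean_tau => //; exact: loc_const_indic.
  - exact: cvm.
  - exact: cvm.
have mK : measurable (K : set (Borel Z)) by exact: measurable_closed.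
rewrite -[in LHS](setCK K) [LHS]probability_setC; last exact: measurableC.
(* The complement of [K] is a countable union of clopen sets. Each has limit mass 0, since orbits
   starting in [K] never meet it. *)
have [C cC KC] := open_bigcup_clopen stZ (closed_openC cK).
rewrite KC [X in (_ - X)%E](_ : _ = 0%E) ?sube0//.
apply/negligibleP; first by rewrite -KC; exact: measurableC.
apply: negligible_bigcup => k; apply/negligibleP; first exact: measurable_clopen.
rewrite [LHS]PE//; congr (_%:E); apply: cvg_lim => //.
rewrite (_ : (fun n => _) = fun=> 0); first exact: cvg_cst.
apply/funext => n; rewrite /empirical_mean big1 ?mulr0// => i _.
have cit : clopen (iter i tau @^-1` C k).
  by apply: preimage_clopen => //; exact: continuous_iter.
rewrite [LHS](Rintegral_indicT (mu n) cit) (_ : mu n _ = 0%E)//.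
have mcit : measurable (iter i tau @^-1` C k : set (Borel Z)) by exact: measurable_clopen.
have mnK : mu n (~` K) = 0%E by rewrite [LHS]probability_setC// muK subee.
have mCK : measurable (~` K : set (Borel Z)) by exact: measurableC.
apply: (@subset_measure0 _ (Borel Z) _ (mu n) _ (~` K) mcit mCK _ mnK).
move=> z /= Cz Kz.
have itK : K (iter i tau z) by elim: (i : nat) => //= j; exact: Ktau.
by have : (~` K) (iter i tau z) by [rewrite KC; exists k].
Qed.

End krylov_bogolyubov.

(** * Configuration spaces *)

(* [agr n] stands for coincidence on the window [-n, n]. *)
Definition resolution (Z : topologicalType) (agr : nat -> Z -> Z -> Prop) : Prop :=
  [/\ forall n z, agr n z z,
      forall n x y z, agr n x y -> agr n x z -> agr n y z,
      forall m n x y, (m <= n)%N -> agr n x y -> agr m x y,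
      forall n z, nbhs z (agr n z) &
      forall z V, nbhs z V -> exists n, agr n z `<=` V].

Section resolution_theory.
Variables (Z : ptopologicalType) (agr : nat -> Z -> Z -> Prop).
Hypothesis ra : resolution agr.

Let arefl n z : agr n z z. Proof. by case: ra. Qed.
Let aeucl n x y z : agr n x y -> agr n x z -> agr n y z.
Proof. by case: ra => _ h _ _ _; exact: h. Qed.
Let amono m n x y : (m <= n)%N -> agr n x y -> agr m x y.
Proof. by case: ra => _ _ h _ _; exact: h. Qed.
Let anbhs n z : nbhs z (agr n z). Proof. by case: ra. Qed.
Let abase z V : nbhs z V -> exists n, agr n z `<=` V.
Proof. by case: ra => _ _ _ _ h; exact: h. Qed.
Let asym n x y : agr n x y -> agr n y x.
Proof. by move=> xy; apply: (aeucl xy (arefl n x)). Qed.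

Lemma agree_loc_const n S (h : Z -> S) :
  (forall z w, agr n z w -> h w = h z) -> loc_const h.
Proof. by move=> hE z; apply: filterS (anbhs n z) => w /hE. Qed.

Lemma agree_ext n z w : agr n z w -> agr n z = agr n w.
Proof.
move=> zw; apply/funext => x; apply/propext; split => [/(aeucl zw)//|wx].
exact: aeucl (asym zw) wx.
Qed.

Lemma agree_clopen n z : clopen (agr n z).
Proof.
have lc : loc_const (agr n) by apply: (@agree_loc_const n) => x y /agree_ext.
rewrite (_ : agr n z = agr n @^-1` [set agr n z]); first exact: loc_const_clopen.
apply/seteqP; split => w /=; first by move=> /agree_ext.
by move=> <-.
Qed.

Lemma stone_of_resolution : compact [set: Z] ->
  (exists e : nat -> set Z, (forall k, clopen (e k)) /\
        forall C, clopen C -> exists k, C = e k) -> stone_space Z.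
Proof.
move=> cZ eZ; split=> // z V /abase[n nV].
by exists (agr n z); split => //; exact: agree_clopen.
Qed.

(** Heine-Cantor: the classes of [agr n] are nested equivalence classes, so the largest index in a
    finite subcover works everywhere. *)
Lemma compact_uniform_agree (R : realType) (K : set Z) (f : Z -> R) (e : R) :
  compact K -> {within K, continuous f} -> 0 < e ->
  exists n, forall z w, K z -> K w -> agr n z w -> `|f z - f w| < e.
Proof.
move=> cK /subspace_continuousP cf e0.
have e20 : 0 < e / 2 by rewrite divr_gt0.
have /choice[N NP] z : exists n, K z -> forall w, K w -> agr n z w -> `|f z - f w| < e / 2.
  have [Kz|nKz] := pselect (K z); last by exists 0%N.
  have := cf z Kz; move=> /cvgrPdist_lt /(_ _ e20).
  rewrite /within /= => /abase[n nV].
  by exists n => _ w Kw /nV; exact.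
have : cover_compact K by rewrite -compact_cover.
move=> /(_ _ K (fun z => agr (N z) z)) [z _|z Kz|D DK KD].
- by have [] := agree_clopen (N z) z.
- by exists z.
exists (\max_(z <- finmap.enum_fset D) N z)%N => z w Kz Kw zw.
have [t /= tD tz] := KD z Kz.
have Kt : K t by have := DK _ tD; rewrite inE.
have tw : agr (N t) t w.
  apply: aeucl (asym tz) _; apply: amono zw.
  by apply: leq_bigmax_seq.
rewrite (le_lt_trans (ler_distD (f t) _ _))// (splitr e).
by rewrite ltrD//; [rewrite distrC; exact: NP|exact: NP].
Qed.

(** The approximation takes the value of [f] at a point chosen in the class of [z] within [K]. The
    choice depends only on the class as a set, and falls back on [point] when the class misses
    [K]. *)
Lemma loc_const_approximation (R : realType) (K : set Z) (f : Z -> R) (e : R) :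
  compact K -> {within K, continuous f} -> 0 < e ->
  exists n (h : Z -> R), (forall z w, agr n z w -> h w = h z) /\
    forall z, K z -> `|f z - h z| < e.
Proof.
move=> cK cf e0; have [n nP] := compact_uniform_agree cK cf e0.
exists n, (fun z => f (xget point (K `&` agr n z))); split=> [z w /agree_ext-> //|z Kz].
have /= [Kw zw] : (K `&` agr n z) (xget point (K `&` agr n z)) by apply: (@xgetI _ _ _ z).
exact: nP.
Qed.

End resolution_theory.

Section configurations.
Variable A : pfinType.

(* [Conf A] gets its topology and its point from two canonical structures     *)
(* without a join, so the pointed topological structure is packed explicitly; *)
(* its sort is convertible to [Conf A].                                       *)
Definition conf_ptop : ptopologicalType :=
  HB.pack (Conf A) (Pointed.on (Conf A)) (Topological.on (Conf A)).

Definition agree n (x y : Conf A) : Prop := forall j : int, (`|j| <= n)%N -> x j = y j.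

Lemma compact_conf : compact [set: Conf A].
Proof.
have fA : finite_set [set: A] by exact: finite_finset.
have := @tychonoff int (fun=> discrete_topology A) (fun=> setT)
  (fun=> @finite_compact (discrete_topology A) _ fA).
by congr (compact _); apply/seteqP; split.
Qed.

Lemma agree_resolution : resolution agree.
Proof.
split=> //.
- by move=> n x y z xy xz j jn; rewrite -xy// xz.
- by move=> m n x y mn xy j jm; apply: xy; exact: leq_trans mn.
- move=> n x.
  have nj (j : int) : \forall y \near (x : Conf A), x j = y j.
    have := @proj_continuous int (fun=> discrete_topology A) j x.
    move=> /(_ [set a | x j = a]); apply; apply: open_nbhs_nbhs; split => //.
    exact: discrete_open.
  (* The window [[-n, n]] is indexed by ordinals through translation by [n], to intersect finitely
     many neighborhoods. *)
  have := @filter_forall _ _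
    (fun (k : 'I_(n + n).+1) (y : Conf A) => x (k%:Z - n%:Z) = y (k%:Z - n%:Z))
    _ (nbhs_filter (x : Conf A)) (fun k => nj _).
  apply: filterS => y xy j jn.
  have kn : (absz (j + Posz n)%R < (n + n).+1)%N by lia.
  have := xy (Ordinal kn).
  by rewrite (_ : Posz (Ordinal kn) - Posz n = j)//= ; lia.
- move=> x V Vx.
  (* The filter generated by the windows around [x] converges to [x], as one checks coordinate by
     coordinate; hence the windows form a basis at [x]. *)
  pose F : set_system (Conf A) := filter_from setT (fun n => [set y | agree n x y]).
  have FF : Filter F.
    apply: filter_from_filter; first by exists 0%N.
    move=> i j _ _; exists (maxn i j) => // y xy; split => k kn; apply: xy.
      by rewrite leq_max kn.
    by rewrite leq_max kn orbT.
  have : F --> (x : Conf A).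
    apply/cvg_sup => j.
    have surj : (fun y : Conf A => y j) @` setT = setT.
      by apply/seteqP; split => // a _; exists (fun=> a).
    apply/cvg_image => // W /nbhs_singleton Wj.
    exists ((fun y : Conf A => y j) @^-1` W); last exact: image_preimage.
    by exists `|j|%N => // y; rewrite /preimage /= => <-.
  by move=> /(_ V Vx) [n _ nV]; exists n.
Qed.

End configurations.

Section clopen_enumeration.
Variables (R : realType).

Lemma clopen_enum (Z : pseudoPMetricType R) : compact [set: Z] ->
  exists e : nat -> set Z, (forall k, clopen (e k)) /\
    forall C, clopen C -> exists k, C = e k.
Proof.
move=> /clopen_surj[e]; exists e; split=> [k|C cC]; first exact: funS.
by have [k _ ek] := 'surj_e cC; exists k.
Qed.

(** The clopen sets are countably many because the space is compact and metrizable; [PM] carries the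
    metric structure. *)
Lemma stone_conf (A : pfinType) : stone_space (conf_ptop A).
Proof.
pose PM : pseudoPMetricType R := HB.pack (Conf A) (Pointed.on (Conf A))
  (PseudoMetric.class (Conf A : pseudoMetricType R)).
apply: (@stone_of_resolution (conf_ptop A) (@agree A) (agree_resolution A)).
  exact: compact_conf.
exact: (@clopen_enum PM (@compact_conf A)).
Qed.

End clopen_enumeration.

Section pairs_of_configurations.
Variables A B : pfinType.

Definition conf2_ptop : ptopologicalType :=
  HB.pack (Conf A * Conf B)%type (Pointed.on (Conf A * Conf B)%type)
    (Topological.on (Conf A * Conf B)%type).

Definition agree2 n (z w : Conf A * Conf B) : Prop :=
  agree n z.1 w.1 /\ agree n z.2 w.2.

Lemma compact_conf2 : compact [set: Conf A * Conf B].
Proof. by rewrite -setXTT; apply: compact_setX; exact: compact_conf. Qed.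

Lemma agree2_resolution : resolution (Z := (Conf A * Conf B)%type) agree2.
Proof.
have [rA eA mA nA bA] := agree_resolution A.
have [rB eB mB nB bB] := agree_resolution B.
split.
- by move=> n z; split.
- by move=> n x y z [a1 b1] [a2 b2]; split; [exact: eA a1 a2|exact: eB b1 b2].
- by move=> m n x y mn [a1 b1]; split; [exact: mA mn a1|exact: mB mn b1].
- move=> n [x y]; exists (agree n x, agree n y) => //.
  by split; [exact: nA|exact: nB].
- move=> [x y] V [[P Q] [/bA [n nP] /bB [m mQ]] PQV].
  exists (maxn n m) => -[x' y'] [/= xx' yy']; apply: PQV; split => /=.
    by apply: nP; exact: mA (leq_maxl n m) xx'.
  by apply: mQ; exact: mB (leq_maxr n m) yy'.
Qed.

Lemma stone_conf2 (R : realType) : stone_space conf2_ptop.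
Proof.
pose PM : pseudoPMetricType R := HB.pack (Conf A * Conf B)%type
  (Pointed.on (Conf A * Conf B)%type)
  (PseudoMetric.class ((Conf A * Conf B)%type : pseudoMetricType R)).
apply: (@stone_of_resolution conf2_ptop agree2 agree2_resolution).
  exact: compact_conf2.
exact: (@clopen_enum R PM compact_conf2).
Qed.

End pairs_of_configurations.

Section shifts.
Variables A B : pfinType.

Lemma agree_shift (C : pfinType) n (x y : Conf C) :
  agree n.+1 x y -> agree n (shift x) (shift y).
Proof. by move=> xy j jn; apply: xy; lia. Qed.

Lemma shift_continuous : continuous (@Defs.shift A : Conf A -> Conf A).
Proof.
move=> x V Vx; have [_ _ _ nA bA] := agree_resolution A.
have [n nV] := bA _ _ Vx; apply: filterS (nA n.+1 x) => y xy.
by apply: nV; exact: agree_shift.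
Qed.

Lemma shift2_continuous : continuous (@shift2 A B : Conf A * Conf B -> Conf A * Conf B).
Proof.
move=> z V Vz; have [_ _ _ n2 b2] := agree2_resolution A B.
have [n nV] := b2 _ _ Vz; apply: filterS (n2 n.+1 z) => w [zw1 zw2].
by apply: nV; split; exact: agree_shift.
Qed.

Lemma iter_shiftE i (x : Conf A) j : iter i shift x j = x (j + i%:Z).
Proof.
elim: i j => [|i IH] j /=; first by rewrite addr0.
by rewrite /shift IH; congr x; lia.
Qed.

Lemma iter_shift2 i (z : Conf A * Conf B) :
  iter i shift2 z = (iter i shift z.1, iter i shift z.2).
Proof. by elim: i => [|i /= ->]; [case: z|]. Qed.

Lemma agree_iter_shift i n (x y : Conf A) :
  agree (n + i) x y -> agree n (iter i shift x) (iter i shift y).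
Proof. by move=> xy j jn; rewrite !iter_shiftE; apply: xy; lia. Qed.

Variables (X : set (Conf A)).
Hypothesis sX : is_shift X.

Lemma shift_iter_sub i x : X x -> X (iter i shift x).
Proof.
have [_ [_ sXX]] := sX; move=> Xx; elim: i => //= i IH.
by rewrite -sXX; exists (iter i shift x).
Qed.

Lemma shift_iter_surj i x : X x -> exists2 y, X y & iter i shift y = x.
Proof.
have [_ [_ sXX]] := sX; elim: i x => [|i IH] x Xx; first by exists x.
have [y Xy <-] : (shift @` X) x by rewrite sXX.
by have [w Xw wy] := IH y Xy; exists w => //=; rewrite wy.
Qed.

End shifts.

(** * Integrals against measures concentrated on a closed set *)

Section concentrated_integral.
Variables (R : realType) (Z : ptopologicalType) (agr : nat -> Z -> Z -> Prop).
Hypotheses (ra : resolution agr) (cZ : compact [set: Z]).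
Variables (K : set Z) (P : probability (Borel Z) R).
Hypotheses (clK : closed K) (PK : P K = 1%E).
Implicit Types (h k f : Z -> R).

Let mK : measurable (K : set (Borel Z)). Proof. exact: measurable_closed. Qed.

Let cK : compact K. Proof. exact: (subclosed_compact clK cZ). Qed.

Lemma Rintegral_concentrated h : loc_const h ->
  \int[P]_(z in setT) h z = \int[P]_(z in K) h z.
Proof.
move=> lh; rewrite /Rintegral; congr fine.
have mCK : measurable (~` K : set (Borel Z)) by exact: measurableC.
have PCK : P (~` K) = 0%E by rewrite [LHS]probability_setC// PK subee.
rewrite (negligible_integral mCK _ (loc_const_integrable cZ P lh) PCK)//.
by rewrite setDE setTI setCK.
Qed.

Lemma le_Rintegral_concentrated h k : loc_const h -> loc_const k ->
  (forall z, K z -> h z <= k z) ->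
  \int[P]_(z in setT) h z <= \int[P]_(z in setT) k z.
Proof.
move=> lh lk hk; rewrite !Rintegral_concentrated//.
apply: le_Rintegral => //.
  by apply: integrableS (loc_const_integrable cZ P lh).
by apply: integrableS (loc_const_integrable cZ P lk).
Qed.

(** On [K], [f] is a pointwise limit of locally constant functions. *)
Lemma continuous_within_measurable f : {within K, continuous f} ->
  measurable_fun (K : set (Borel Z)) (f : Borel Z -> R).
Proof.
move=> cf.
have /choice[h hP] n : exists h, loc_const h /\ forall z, K z -> `|f z - h z| < n.+1%:R^-1.
  have [|N [h [hE fh]]] := loc_const_approximation ra cK cf (_ : 0 < n.+1%:R^-1).
    by rewrite invr_gt0.
  by exists h; split => //; exact: (agree_loc_const ra hE).
apply/measurable_EFinP.
apply: (@emeasurable_fun_cvg _ (Borel Z) R K (fun n z => (h n z)%:E)) => [n|z Kz].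
  apply/measurable_EFinP; apply: measurable_funTS.
  by have [lh _] := hP n; exact: loc_const_measurable.
apply: cvg_EFin; first by apply: nearW.
apply/cvgrPdist_lt => e e0.
have := @cvg_harmonic R; move=> /cvgrPdist_lt /(_ e e0); apply: filterS => n.
rewrite sub0r normrN /= => ne; have [_ fh] := hP n.
apply: lt_trans (fh z Kz) _; apply: le_lt_trans ne.
by rewrite ler_norm.
Qed.

Lemma continuous_within_integrable f : {within K, continuous f} ->
  P.-integrable K (EFin \o f).
Proof.
move=> cf; apply: measurable_bounded_integrable => //.
- by rewrite [ltLHS]PK ltry.
- exact: continuous_within_measurable.
- have [N [h [hE fh]]] := loc_const_approximation ra cK cf ltr01.
  have [M hM] := loc_const_bounded cZ (agree_loc_const ra hE).
  exists (1 + M); split; first exact: num_real.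
  move=> M' MM' z Kz /=; apply: le_trans (ltW MM').
  by rewrite -(subrK (h z) (f z)) (le_trans (ler_normD _ _))// lerD// ltW// fh.
Qed.

Lemma Rintegral_approximation f h (e : R) : {within K, continuous f} -> loc_const h ->
  (forall z, K z -> `|f z - h z| <= e) ->
  (\int[P]_(z in K) (f z)%:E)%E \is a fin_num /\
  `|\int[P]_(z in K) f z - \int[P]_(z in setT) h z| <= e.
Proof.
move=> cf lh fh; have intf := continuous_within_integrable cf.
split; first exact: integrable_fin_num.
have lc (r : R) : loc_const (fun z => h z + r).
  exact: (loc_const_fun1 (fun x => x + r) lh).
have intc r : P.-integrable K (EFin \o (fun z => h z + r)).
  by apply: integrableS (loc_const_integrable cZ P (lc r)).
have intE r : \int[P]_(z in K) (h z + r) = \int[P]_(z in setT) h z + r.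
  rewrite -Rintegral_concentrated// (Rintegral_loc_constD cZ)//.
    by rewrite Rintegral_prob_cst.
  exact: loc_const_cst.
rewrite ler_norml; apply/andP; split.
- rewrite lerBrDl -intE; apply: le_Rintegral => // z Kz; have := fh z Kz.
  by rewrite ler_norml => /andP[+ _]; rewrite lerBrDl.
- rewrite lerBlDl -intE; apply: le_Rintegral => // z Kz; have := fh z Kz.
  by rewrite ler_norml => /andP[_]; rewrite lerBlDl.
Qed.

End concentrated_integral.

(** * Fiberwise minima of Birkhoff sums *)

Section fiberwise_minimal_sums.
Variables (R : realType) (A B : pfinType) (X : set (Conf A)).
Variables (h : Conf A * Conf B -> R) (M : nat) (F : R).
Hypotheses (sX : is_shift X) (hM : forall z w, agree2 M z w -> h w = h z).
Hypothesis hF : forall z, `|h z| <= F.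

Definition birkhoff n (x : Conf A) (y : Conf B) : R :=
  \sum_(i < n) h (iter i shift x, iter i shift y).

Definition fiber_min n (y : Conf B) : R := inf [set birkhoff n x y | x in X].

Let F0 : 0 <= F. Proof. exact: le_trans (normr_ge0 _) (hF point). Qed.

Lemma birkhoff_norm n x y : `|birkhoff n x y| <= n%:R * F.
Proof.
apply: (le_trans (ler_norm_sum _ _ _)).
apply: (le_trans (ler_sum _ (fun i _ => hF _))).
by rewrite sumr_const card_ord mulr_natl.
Qed.

Lemma birkhoffD n m x y :
  birkhoff (n + m) x y = birkhoff n x y + birkhoff m (iter n shift x) (iter n shift y).
Proof.
rewrite /birkhoff big_split_ord /=; congr (_ + _); apply: eq_bigr => i _.
by rewrite -!iterD addnC.
Qed.

Lemma birkhoff_agree n x y x' y' :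
  agree (M + n) x x' -> agree (M + n) y y' -> birkhoff n x y = birkhoff n x' y'.
Proof.
move=> xx' yy'; apply: eq_bigr => i _; apply/esym/hM.
have iM : (M + i <= M + n)%N by rewrite leq_add2l ltnW.
by split => /=; apply: agree_iter_shift => j jn;
  [apply: xx'|apply: yy']; exact: leq_trans iM.
Qed.

Lemma has_inf_birkhoff n y : has_inf [set birkhoff n x y | x in X].
Proof.
have [[x Xx] _] := sX; split; first by exists (birkhoff n x y), x.
exists (- (n%:R * F)) => _ [x' _ <-].
by have := birkhoff_norm n x' y; rewrite ler_norml => /andP[].
Qed.

Lemma fiber_min_le n x y : X x -> fiber_min n y <= birkhoff n x y.
Proof. by move=> Xx; apply: ge_inf; [have [] := has_inf_birkhoff n y|exists x]. Qed.

Lemma fiber_min_ge n y c : (forall x, X x -> c <= birkhoff n x y) -> c <= fiber_min n y.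
Proof.
move=> cx; apply: lb_le_inf; first by have [] := has_inf_birkhoff n y.
by move=> _ [x Xx <-]; exact: cx.
Qed.

Lemma fiber_min_adherent n y (e : R) : 0 < e ->
  exists2 x, X x & birkhoff n x y < fiber_min n y + e.
Proof.
move=> e0; have [_ [x Xx <-] xe] := inf_adherent e0 (has_inf_birkhoff n y).
by exists x.
Qed.

Lemma fiber_min_loc_const n : loc_const (Z := conf_ptop B) (fiber_min n).
Proof.
(* The first [n] terms of the Birkhoff sum read only coordinates in the window of radius [M + n]. *)
apply: (@agree_loc_const (conf_ptop B) (@agree B) (agree_resolution B) (M + n)) => y y' yy'.
rewrite /fiber_min; congr inf; apply/seteqP; split => _ [x Xx <-]; exists x => //.
  exact: birkhoff_agree.
by apply/esym; exact: birkhoff_agree.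
Qed.

(** Any point of [X] competes in both blocks: on the second one through its shift, which stays in
    [X]. *)
Lemma fiber_min_superadditive n m y :
  fiber_min n y + fiber_min m (iter n shift y) <= fiber_min (n + m) y.
Proof.
apply: fiber_min_ge => x Xx; rewrite birkhoffD lerD ?fiber_min_le//.
exact: shift_iter_sub.
Qed.

Let sum_head (d : nat -> R) n k : (forall i, `|d i| <= F + F) ->
  (forall i, (k <= i)%N -> d i = 0) -> `|\sum_(i < n) d i| <= k%:R * (F + F).
Proof.
move=> dF d0; apply: (le_trans (ler_norm_sum _ _ _)).
have FF0 : 0 <= F + F by rewrite addr_ge0.
apply: (@le_trans _ _ ((minn n k)%:R * (F + F))); last first.
  by rewrite ler_wpM2r// ler_nat geq_minr.
elim: n => [|n IH]; first by rewrite big_ord0 min0n mul0r.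
rewrite big_ord_recr /=; have [nk|kn] := ltnP n k.
  rewrite (minn_idPl nk) -natr1 mulrDl mul1r lerD//.
  by rewrite (minn_idPl (ltnW nk)) in IH.
by rewrite d0// normr0 addr0 (minn_idPr (leqW kn)) -(minn_idPr kn).
Qed.

Let sum_tail (d : nat -> R) n k : (forall i, `|d i| <= F + F) ->
  (forall i, (i + k <= n)%N -> d i = 0) -> `|\sum_(i < n) d i| <= k%:R * (F + F).
Proof.
move=> dF d0; rewrite (reindex_inj rev_ord_inj) /=.
pose d' i := if (i < n)%N then d (n - i.+1)%N else 0.
rewrite (eq_bigr (fun i : 'I_n => d' i)); last by move=> i _; rewrite /d' ltn_ord.
apply: sum_head => i; rewrite /d'; case: ifP => // li; rewrite ?normr0 ?addr_ge0// => ki.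
by apply: d0; lia.
Qed.

Hypothesis tX : transitive_shift X.

(* Glueing a near-minimizer of the first block to one of the second costs a *)
(* bounded amount, independent of the lengths of the blocks.                *)
Lemma fiber_min_subadditive : exists C, 0 <= C /\ forall n m y,
  fiber_min (n + m) y <= fiber_min n y + fiber_min m (iter n shift y) + C.
Proof.
have [D glue] := tX.
(* The glued point can differ from the near-minimizers in the last [M] terms of the first block and
   the first [D + M] terms of the second; each term costs at most [F + F]. *)
exists ((M + (D + M))%:R * (F + F)); split.
  by rewrite mulr_ge0// addr_ge0.
move=> n m y; apply/ler_addgt0Pr => e e0.
have e20 : 0 < e / 2 by rewrite divr_gt0.
have [x1 Xx1 x1e] := fiber_min_adherent n y e20.
have [x2 Xx2 x2e] := fiber_min_adherent m (iter n shift y) e20.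
(* [x2] is pulled back by [n] so that it occupies the coordinates of the second block; the gap for
   glueing is [[n, n + D]]. *)
have [x3 Xx3 x32] := shift_iter_surj sX n Xx2.
have [|x' [Xx' [x'1 x'3]]] := glue x1 x3 Xx1 Xx3 n%:Z (n + D)%N%:Z; first by lia.
have dF a b : `|h a - h b| <= F + F.
  by apply: (le_trans (ler_normB _ _)); exact: lerD.
have b1 : birkhoff n x' y - birkhoff n x1 y <= M%:R * (F + F).
  rewrite /birkhoff -sumrB; apply: le_trans (ler_norm _) _.
  apply: (@sum_tail (fun i => h (iter i shift x', iter i shift y) -
    h (iter i shift x1, iter i shift y))) => [i|i iM].
    exact: dF.
  apply/eqP; rewrite subr_eq0; apply/eqP/hM; split => //= j jM.
  by rewrite !iter_shiftE x'1//; lia.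
have b2 : birkhoff m (iter n shift x') (iter n shift y) - birkhoff m x2 (iter n shift y)
    <= (D + M)%:R * (F + F).
  rewrite /birkhoff -sumrB; apply: le_trans (ler_norm _) _.
  apply: (@sum_head (fun i =>
    h (iter i shift (iter n shift x'), iter i shift (iter n shift y)) -
    h (iter i shift x2, iter i shift (iter n shift y)))) => [i|i iM].
    exact: dF.
  apply/eqP; rewrite subr_eq0; apply/eqP/hM; split => //= j jM.
  by rewrite -x32 !iter_shiftE x'3//; lia.
have := fiber_min_le (n + m) y Xx'; rewrite birkhoffD natrD mulrDl.
lra.
Qed.

End fiberwise_minimal_sums.

(** * Invariant measures and mean fiberwise minima *)

Lemma invariant_iter (R : realType) (Z : ptopologicalType) (t : Z -> Z)
    (P : probability (Borel Z) R) n (C : set Z) :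
  continuous t -> invariant (t : Borel Z -> Borel Z) P -> clopen C ->
  P (iter n t @^-1` C) = P C.
Proof.
move=> ct iP cC; elim: n => [//|n IH]; rewrite -[RHS]IH.
have cn : clopen (iter n t @^-1` C) by apply: preimage_clopen => //; exact: continuous_iter.
rewrite -[RHS](iP _ (measurable_clopen cn)); congr (P _).
by apply/seteqP; split => z; rewrite /preimage /= -iterS iterSr.
Qed.

Lemma Rintegral_invariant_iter (R : realType) (Z : ptopologicalType) (t : Z -> Z)
    (P : probability (Borel Z) R) n (h : Z -> R) :
  compact [set: Z] -> continuous t -> invariant (t : Borel Z -> Borel Z) P ->
  loc_const h -> \int[P]_(z in setT) h (iter n t z) = \int[P]_(z in setT) h z.
Proof.
move=> cZ ct iP lh; apply: (@Rintegral_loc_const_comp R Z Z P P) => //.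
  by move=> C cC; exact: invariant_iter.
exact: (loc_const_comp (continuous_iter (n := n) ct) lh).
Qed.

Lemma loc_const_sum (R : realType) (Z : ptopologicalType) n (h : nat -> Z -> R) :
  (forall i, loc_const (h i)) -> loc_const (fun z => \sum_(i < n) h i z).
Proof.
move=> lh; elim: n => [|n IH] z; first by apply: nearW => z'; rewrite !big_ord0.
by apply: filterS2 (IH z) (lh n z) => z' e1 e2; rewrite !big_ord_recr /= e1 e2.
Qed.

Lemma Rintegral_loc_const_sum (R : realType) (Z : ptopologicalType)
    (P : probability (Borel Z) R) n (h : nat -> Z -> R) :
  compact [set: Z] -> (forall i, loc_const (h i)) ->
  \int[P]_(z in setT) (\sum_(i < n) h i z) = \sum_(i < n) \int[P]_(z in setT) h i z.
Proof.
move=> cZ lh; elim: n => [|n IH].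
  rewrite big_ord0 -[RHS](Rintegral_prob_cst P); apply: eq_Rintegral => z _.
  by rewrite big_ord0.
rewrite big_ord_recr /= -IH -(Rintegral_loc_constD cZ) => //; last exact: loc_const_sum.
by apply: eq_Rintegral => z _; rewrite big_ord_recr.
Qed.

Section mean_fiber_min.
Variables (R : realType) (A B : pfinType) (X : set (Conf A)).
Variables (h : Conf A * Conf B -> R) (M : nat) (F : R).
Hypotheses (sX : is_shift X) (hM : forall z w, agree2 M z w -> h w = h z).
Hypothesis hF : forall z, `|h z| <= F.
Variable nu : probability (Borel (Conf B)) R.
Hypothesis inu : invariant (shift : Borel (Conf B) -> Borel (Conf B)) nu.

Definition mean_fiber_min n : R := \int[nu]_(y in setT) fiber_min X h n y.

Let cB : compact [set: conf_ptop B]. Proof. exact: compact_conf. Qed.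

Let lg n : loc_const (Z := conf_ptop B) (fiber_min X h n).
Proof. exact: fiber_min_loc_const hM n. Qed.

Let lgi n m : loc_const (Z := conf_ptop B) (fun y => fiber_min X h m (iter n shift y)).
Proof.
by apply: (@loc_const_comp (conf_ptop B) _ _ (iter n shift)) => //;
  apply: continuous_iter; exact: shift_continuous.
Qed.

Let mean_shift n m : \int[nu]_(y in setT) fiber_min X h m (iter n shift y) = mean_fiber_min m.
Proof.
by apply: (@Rintegral_invariant_iter R (conf_ptop B)) => //; exact: shift_continuous.
Qed.

Let mean0 : mean_fiber_min 0 = 0.
Proof.
rewrite /mean_fiber_min -[RHS](Rintegral_prob_cst (Z := conf_ptop B) nu).
apply: eq_Rintegral => y _; apply/eqP; rewrite eq_le; apply/andP; split.
  have [[x Xx] _] := sX.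
  by have := fiber_min_le sX hF 0 y Xx; rewrite /birkhoff big_ord0.
by apply: (fiber_min_ge sX hF) => x Xx; rewrite /birkhoff big_ord0.
Qed.

Lemma mean_fiber_min_superadditive n m :
  mean_fiber_min n + mean_fiber_min m <= mean_fiber_min (n + m).
Proof.
rewrite -(mean_shift n m) -(Rintegral_loc_constD (Z := conf_ptop B) cB)//.
apply: (le_Rintegral_loc_const (Z := conf_ptop B) cB) => //.
  exact: loc_const_fun2.
by move=> y; exact: (fiber_min_superadditive sX hF).
Qed.

Lemma mean_fiber_min_mul_ge k n : k%:R * mean_fiber_min n <= mean_fiber_min (k * n).
Proof.
elim: k => [|k IH]; first by rewrite mul0r mul0n mean0.
rewrite mulSn -natr1 mulrDl mul1r addrC.
by apply: le_trans (mean_fiber_min_superadditive _ _); rewrite lerD2l.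
Qed.

Variable C : R.
Hypothesis gC : forall n m y,
  fiber_min X h (n + m) y <= fiber_min X h n y + fiber_min X h m (iter n shift y) + C.

Lemma mean_fiber_min_subadditive n m :
  mean_fiber_min (n + m) <= mean_fiber_min n + mean_fiber_min m + C.
Proof.
rewrite -(mean_shift n m) -(Rintegral_loc_constD (Z := conf_ptop B) cB)//.
have lc : loc_const (Z := conf_ptop B) (fun=> C).
  exact: loc_const_cst.
have ls : loc_const (Z := conf_ptop B)
  (fun y => fiber_min X h n y + fiber_min X h m (iter n shift y)) by exact: loc_const_fun2.
rewrite -[X in _ + X](Rintegral_prob_cst (Z := conf_ptop B) nu C).
rewrite -(Rintegral_loc_constD (Z := conf_ptop B) cB)//.
by apply: (le_Rintegral_loc_const (Z := conf_ptop B) cB) => //; exact: (loc_const_fun2 +%R).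
Qed.

Lemma mean_fiber_min_mul_le k n : mean_fiber_min (k * n) <= k%:R * (mean_fiber_min n + C).
Proof.
elim: k => [|k IH]; first by rewrite mul0r mul0n mean0.
rewrite mulSn -natr1 mulrDl mul1r.
by have := mean_fiber_min_subadditive n (k * n); lra.
Qed.

(** A block of length [n * N] is cut in two ways: into [n] blocks of length [N] for the lower bound,
    into [N] blocks of length [n] for the upper bound. *)
Lemma mean_fiber_min_slope N n :
  n%:R * mean_fiber_min N <= N%:R * (mean_fiber_min n + C).
Proof.
apply: le_trans (mean_fiber_min_mul_ge _ _) _.
by rewrite mulnC; exact: mean_fiber_min_mul_le.
Qed.

End mean_fiber_min.

(** * Couplings *)

Lemma conf_closed (A : pfinType) (X : set (Conf A)) : compact X -> closed X.
Proof.
apply: compact_closed.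
apply: (@hausdorff_product int (fun=> discrete_topology A)) => _.
exact: discrete_hausdorff.
Qed.

Section coupling_bounds.
Variables (R : realType) (A B : pfinType) (X : set (Conf A)) (Y : set (Conf B)).
Variables (h : Conf A * Conf B -> R) (M : nat) (F : R).
Hypotheses (sX : is_shift X) (sY : is_shift Y).
Hypotheses (hM : forall z w, agree2 M z w -> h w = h z) (hF : forall z, `|h z| <= F).

Let Z := conf2_ptop A B.
Let cZ : compact [set: Z]. Proof. exact: compact_conf2. Qed.
Let cB : compact [set: conf_ptop B]. Proof. exact: compact_conf. Qed.

Let lh : loc_const (Z := Z) h.
Proof. exact: (@agree_loc_const Z _ (agree2_resolution A B) M). Qed.

Let csnd : continuous (snd : Z -> conf_ptop B). Proof. by move=> z; exact: cvg_snd. Qed.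
Let cfst : continuous (fst : Z -> conf_ptop A). Proof. by move=> z; exact: cvg_fst. Qed.
Let cshift2 : continuous (shift2 : Z -> Z). Proof. exact: shift2_continuous. Qed.

Lemma closed_rectangle : closed (X `*` Y : set Z).
Proof.
rewrite (_ : X `*` Y = (fst @^-1` X) `&` (snd @^-1` Y))//.
have [_ [cX _]] := sX; have [_ [cY _]] := sY.
by apply: closedI; apply: preimage_closed => //; exact: conf_closed.
Qed.

Let lhi i : loc_const (Z := Z) (fun z => h (iter i shift2 z)).
Proof. exact: (loc_const_comp (continuous_iter (n := i) cshift2) lh). Qed.

Let birkhoffE n (z : Z) : birkhoff h n z.1 z.2 = \sum_(i < n) h (iter i shift2 z).
Proof. by apply: eq_bigr => i _; rewrite iter_shift2. Qed.

(** By invariance of [l] the right side is the integral of the Birkhoff sum. On [X] times [Y] this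
    sum dominates the fiberwise infimum, which depends on [y] only and so integrates through
    [nu]. *)
Lemma coupling_mean_ge nu l n : couplings X Y nu l ->
  mean_fiber_min X h nu n <= n%:R * \int[l]_(z in setT) h z.
Proof.
move=> [lXY [il lnu]].
have -> : n%:R * \int[l]_(z in setT) h z = \int[l]_(z in setT) birkhoff h n z.1 z.2.
  rewrite (_ : (fun z => birkhoff h n z.1 z.2) = (fun z => \sum_(i < n) h (iter i shift2 z))).
    2: by apply/funext => z; exact: birkhoffE.
  rewrite (Rintegral_loc_const_sum (Z := Z) l n (h := fun i z => h (iter i shift2 z)))//.
  have hi i : \int[l]_(z in setT) h (iter i shift2 z) = \int[l]_(z in setT) h z.
    exact: (@Rintegral_invariant_iter R Z shift2 l i h cZ cshift2 il lh).
  rewrite (eq_bigr _ (fun (i : 'I_n) _ => hi i)).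
  by move: (\int[l]_(z in setT) h z) => c; rewrite sumr_const card_ord mulr_natl.
have lg : loc_const (Z := conf_ptop B) (fiber_min X h n) by exact: fiber_min_loc_const hM n.
have lgs : loc_const (Z := Z) (fun z => fiber_min X h n z.2).
  exact: (loc_const_comp csnd lg).
have <- : \int[l]_(z in setT) fiber_min X h n z.2 = mean_fiber_min X h nu n.
  apply: (@Rintegral_loc_const_comp R Z (conf_ptop B) l nu snd) => // C cC.
  by apply: lnu; exact: (measurable_clopen (Z := conf_ptop B)).
apply: (le_Rintegral_concentrated (Z := Z) cZ closed_rectangle lXY) => //.
  rewrite (_ : (fun z => _) = (fun z => \sum_(i < n) h (iter i shift2 z))).
    exact: (loc_const_sum (Z := Z) n (h := fun i z => h (iter i shift2 z))).
  by apply/funext => z; exact: birkhoffE.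
by move=> z [Xz Yz]; exact: (fiber_min_le sX hF).
Qed.

End coupling_bounds.

Section coupling_existence.
Variables (R : realType) (A B : pfinType) (X : set (Conf A)) (Y : set (Conf B)).
Variables (h : Conf A * Conf B -> R) (M : nat) (F : R).
Hypotheses (sX : is_shift X) (sY : is_shift Y).
Hypotheses (hM : forall z w, agree2 M z w -> h w = h z) (hF : forall z, `|h z| <= F).

Let Z := conf2_ptop A B.
Let cZ : compact [set: Z]. Proof. exact: compact_conf2. Qed.
Let cB : compact [set: conf_ptop B]. Proof. exact: compact_conf. Qed.

Let lh : loc_const (Z := Z) h.
Proof. exact: (@agree_loc_const Z _ (agree2_resolution A B) M). Qed.

Let csnd : continuous (snd : Z -> conf_ptop B). Proof. by move=> z; exact: cvg_snd. Qed.
Let cshift2 : continuous (shift2 : Z -> Z). Proof. exact: shift2_continuous. Qed.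
Let cshift : continuous (shift : conf_ptop B -> conf_ptop B).
Proof. exact: shift_continuous. Qed.

(* [xget] depends only on the set it chooses from, hence here only on a finite *)
(* window of [y]: the selection is locally constant.                          *)
Definition near_minimizer n (y : Conf B) : Conf A :=
  xget point [set x | X x /\ birkhoff h n x y < fiber_min X h n y + 1].

Lemma near_minimizerP n y : X (near_minimizer n y) /\
  birkhoff h n (near_minimizer n y) y < fiber_min X h n y + 1.
Proof.
have [x Xx xe] := fiber_min_adherent sX hF n y ltr01.
exact: (@xgetI _ _ [set x | X x /\ birkhoff h n x y < fiber_min X h n y + 1] x).
Qed.

Definition near_minimizer_graph n (y : Conf B) : Conf A * Conf B :=
  (near_minimizer n y, y).

Lemma near_minimizer_graph_continuous n :
  continuous (near_minimizer_graph n : conf_ptop B -> Z).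
Proof.
move=> y V Vy; have [_ _ _ _ b2] := agree2_resolution A B.
have [_ _ mB nB _] := agree_resolution B.
have [m mV] := b2 _ _ Vy.
apply: filterS (nB (maxn m (M + n)) y) => y' yy'; apply: mV; split => /=; last first.
  exact: mB (leq_maxl _ _) yy'.
have yn : agree (M + n) y y' := mB _ _ _ _ (leq_maxr _ _) yy'.
have bE x : birkhoff h n x y = birkhoff h n x y'.
  by apply: (birkhoff_agree hM _ yn) => j _.
have gE : fiber_min X h n y = fiber_min X h n y'.
  by rewrite /fiber_min; congr inf; apply/seteqP; split => _ [x Xx <-]; exists x.
rewrite (_ : near_minimizer n y = near_minimizer n y')//.
rewrite /near_minimizer; congr xget; apply/seteqP; split => x /= [Xx xy]; split => //.
  by rewrite -bE -gE.
by rewrite bE gE.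
Qed.

Variable nu : probability (Borel (Conf B)) R.
Hypothesis nuY : MS Y nu.

(** The index is offset because [empirical_mean n] averages [n.+1] iterates. *)
Lemma near_minimizer_measures : exists mu : nat -> probability (Borel Z) R,
  forall n, (forall E, mu n E = nu (near_minimizer_graph n.+1 @^-1` E)).
Proof.
have : forall n, exists m : probability (Borel Z) R,
    forall E, m E = nu (near_minimizer_graph n.+1 @^-1` E).
  move=> n; apply: (@pushforward_probability R _ _ (Borel (conf_ptop B)) (Borel Z) nu).
    by apply: continuous_borel_measurable; exact: near_minimizer_graph_continuous.
  exact: probability_setT.
by move=> /choice[mu muE]; exists mu.
Qed.

Variable C : R.
Hypothesis gC : forall n m y,
  fiber_min X h (n + m) y <= fiber_min X h n y + fiber_min X h m (iter n shift y) + C.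

(** One limit coupling serves all [n]. Its value of [h] is a limit of means bounded by the slopes at
    length [N.+1], and [mean_fiber_min_slope] compares these with the slope at [n]. *)
Lemma coupling_exists : exists2 l, couplings X Y nu l &
  forall n, n%:R * \int[l]_(z in setT) h z <= mean_fiber_min X h nu n + C.
Proof.
have [nY inu] := nuY.
have [mu muE] := near_minimizer_measures.
have [U [UF ooU]] := ultraFilterLemma (eventually_filter : ProperFilter (\oo : set_system nat)).
have muXY n : mu n (X `*` Y) = 1%E.
  rewrite muE -[RHS]nY; congr (nu _); apply/seteqP; split => y /=; first by case.
  by split => //; have [] := near_minimizerP n.+1 y.
have XYs (z : Z) : (X `*` Y) z -> (X `*` Y) (shift2 z).
  by move=> [Xz Yz]; split; [exact: (shift_iter_sub sX 1)|exact: (shift_iter_sub sY 1)].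
have clXY : closed (X `*` Y : set Z) by exact: closed_rectangle.
have [l [lXY il lh_lim]] := krylov_bogolyubov (stone_conf2 A B R) UF ooU cshift2 clXY XYs muXY.
have lphi n (k : Z -> R) : loc_const (Z := Z) k ->
    loc_const (Z := conf_ptop B) (fun y => k (near_minimizer_graph n y)).
  by move=> lk; exact: (loc_const_comp (@near_minimizer_graph_continuous n) lk).
have mu_nu n (k : Z -> R) : loc_const (Z := Z) k ->
    \int[mu n]_(z in setT) k z = \int[nu]_(y in setT) k (near_minimizer_graph n.+1 y).
  move=> lk; apply/esym.
  apply: (@Rintegral_loc_const_comp R (conf_ptop B) Z nu (mu n)) => //; last exact: lphi.
have lit i (k : Z -> R) : loc_const (Z := Z) k ->
    loc_const (Z := Z) (fun z => k (iter i shift2 z)).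
  by move=> lk; exact: (loc_const_comp (continuous_iter (n := i) cshift2) lk).
apply: (ex_intro2 _ _ (l : probability (Borel (Conf A * Conf B)%type) R)).
  split; first exact: lXY.
  split; first exact: il.
  have [Q QE] : exists Q : probability (Borel (conf_ptop B)) R, forall E, Q E = l (snd @^-1` E).
    apply: (@pushforward_probability R _ _ (Borel Z) (Borel (conf_ptop B)) l).
      exact: continuous_borel_measurable.
    exact: probability_setT.
  move=> E mE; rewrite -QE.
  apply: (@eq_probability R (conf_ptop B) (stone_conf R B) Q nu) => //.
    exact: probability_setT.
  move=> D cD; transitivity (l (snd @^-1` D)); first exact: QE.
  pose sD : set Z := snd @^-1` D.
  have cD2 : clopen sD by exact: preimage_clopen.
  (* Shifting commutes with the projection and [nu] is invariant, so the second marginal is already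
     [nu] before the limit. *)
  have meanE n : empirical_mean (Z := Z) shift2 mu n (\1_sD : Z -> R) = fine (nu D) :> R.
    rewrite /empirical_mean (eq_bigr (fun=> fine (nu (D : set (Borel (Conf B)))))); last first.
      move=> i _.
      have ci : clopen (iter i shift2 @^-1` sD : set Z).
        by apply: preimage_clopen => //; exact: continuous_iter.
      transitivity (fine (mu n (iter i shift2 @^-1` sD))).
        by rewrite -(@Rintegral_indicT R Z (mu n) _ ci).
      rewrite muE -(@invariant_iter R (conf_ptop B) shift nu i D cshift inu cD).
      by congr (fine (nu _)); apply/seteqP; split => y; rewrite /preimage /= iter_shift2.
    move: (fine (nu D)) => c.
    by rewrite sumr_const card_ord -[c *+ _]mulr_natl mulKf// pnatr_eq0.
  have lim1 := lh_lim _ (loc_const_indic R cD2).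
  have lim2 : empirical_mean (Z := Z) shift2 mu n (\1_sD : Z -> R) @[n --> U] --> fine (nu D).
    by rewrite (_ : (fun n => _) = fun=> fine (nu D));
      [exact: cvg_cst | apply/funext => n; exact: meanE].
  have := cvg_unique _ lim1 lim2; rewrite (@Rintegral_indicT R Z l _ cD2) => e.
  have mD := measurable_clopen cD.
  have mD2 := measurable_clopen cD2.
  have f1 := fin_num_measure l _ mD2; have f2 := fin_num_measure nu _ mD.
  have e1 : (fine (l sD))%:E = l sD by rewrite fineK.
  have e2 : (fine (nu D))%:E = nu D by rewrite fineK.
  transitivity ((fine (l sD))%:E); first exact: esym.
  by rewrite e.
move=> n.
(* The sum of [h] along the orbit of a graph point is the near-minimal Birkhoff sum; the added 1 is
   the slack in [near_minimizer]. *)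
have mean_le N : empirical_mean (Z := Z) shift2 mu N h <=
    N.+1%:R^-1 * (mean_fiber_min X h nu N.+1 + 1).
  rewrite /empirical_mean ler_wpM2l ?invr_ge0//.
  rewrite (eq_bigr (fun i : 'I_N.+1 =>
      \int[nu]_(y in setT) h (iter i shift2 (near_minimizer_graph N.+1 y)))); last first.
    by move=> i _; exact: (mu_nu N _ (lit i h lh)).
  rewrite -(@Rintegral_loc_const_sum R (conf_ptop B) nu N.+1
    (fun i y => h (iter i shift2 (near_minimizer_graph N.+1 y))) cB); last first.
    by move=> i; exact: (lphi N.+1 _ (lit i h lh)).
  have lg : loc_const (Z := conf_ptop B) (fiber_min X h N.+1).
    exact: fiber_min_loc_const hM N.+1.
  have l1 : loc_const (Z := conf_ptop B) (fun=> 1 : R) by exact: loc_const_cst.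
  rewrite /mean_fiber_min -[X in _ + X](Rintegral_prob_cst (Z := conf_ptop B) nu 1).
  rewrite -(@Rintegral_loc_constD R (conf_ptop B) cB nu _ _ lg l1).
  apply: (@le_Rintegral_loc_const R (conf_ptop B) cB nu).
  - apply: (@loc_const_sum R (conf_ptop B) N.+1
      (fun i y => h (iter i shift2 (near_minimizer_graph N.+1 y)))).
    by move=> i; exact: (lphi N.+1 _ (lit i h lh)).
  - exact: (loc_const_fun2 +%R lg l1).
  - move=> y; have [_ /ltW] := near_minimizerP N.+1 y; apply: le_trans.
    by rewrite le_eqVlt; apply/orP; left; apply/eqP; apply: eq_bigr => i _; rewrite iter_shift2.
have lim1 : n%:R * empirical_mean (Z := Z) shift2 mu N h @[N --> U] -->
    n%:R * \int[l]_(z in setT) h z.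
  by apply: cvgMl_tmp; exact: lh_lim.
(* After multiplication by [n] the slack contributes [n / N.+1], which vanishes in the limit. *)
have lim2 : mean_fiber_min X h nu n + C + n%:R / N.+1%:R @[N --> U] -->
    mean_fiber_min X h nu n + C + 0.
  by apply: cvgD; [exact: cvg_cst | exact: ultra_invS].
rewrite -[leRHS]addr0; apply: (ler_cvg_to lim1 lim2); apply: nearW => N.
have slope := mean_fiber_min_slope sX hM hF inu gC N.+1 n.
apply: (@le_trans _ _ (n%:R * (N.+1%:R^-1 * (mean_fiber_min X h nu N.+1 + 1)))).
  by rewrite ler_wpM2l.
rewrite mulrCA mulrDr mulr1 mulrDr [leRHS]addrC -(addrC (N.+1%:R^-1 * n%:R)) mulrC lerD2l.
by rewrite ler_pdivrMl.
Qed.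

End coupling_existence.

(** * Functionals approximated by integrals of locally constant functions *)

Section approximable_functionals.
Variables (R : realType) (B : pfinType) (Y : set (Conf B)).
Hypothesis sY : is_shift Y.

Let Z := conf_ptop B.
Let cZ : compact [set: Z]. Proof. exact: compact_conf. Qed.
Let cshift : continuous (shift : Z -> Z). Proof. exact: shift_continuous. Qed.
Let clY : closed (Y : set Z).
Proof. by have [_ [cY _]] := sY; exact: conf_closed. Qed.
Let shY (y : Z) : Y y -> Y (shift y). Proof. exact: (shift_iter_sub sY 1). Qed.

(** Uniform limits on [MS Y] of integrals of locally constant functions. Weak* continuity, affinity,
    boundedness and convergence along ultralimits all pass to such limits. *)
Definition approximable (Phi : probability (Borel (Conf B)) R -> R) : Prop :=
  forall e : R, 0 < e -> exists2 g : conf_ptop B -> R, loc_const g &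
    forall nu, MS Y nu -> `|Phi nu - \int[nu]_(y in setT) g y| <= e.

Lemma approximable_weak_star Phi : approximable Phi ->
  weak_star_continuous_on Y (MS Y) Phi.
Proof.
move=> aPhi nu nuY e e0.
have e30 : 0 < e / 3 by rewrite divr_gt0.
have [g lg gP] := aPhi _ e30.
exists 1%N, (fun=> g), (e / 3); split=> //; split.
  have cg : continuous (g : Z -> R).
    by move=> y V /nbhs_singleton Vg; apply: filterS (lg y) => z /= ->.
  by move=> _; exact: (@continuous_subspaceT Z R Y g cg).
move=> nu' nu'Y /(_ ord0).
have intYE m : MS Y m -> intY Y m g = \int[m]_(y in setT) g y.
  move=> [mY _]; apply/esym.
  exact: (@Rintegral_concentrated R Z cZ Y m clY mY g lg).
rewrite !intYE// => gg'.
have := gP _ nuY; have := gP _ nu'Y; move: gg'.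
rewrite !ler_norml !ltr_norml.
move=> /andP[? ?] /andP[? ?] /andP[? ?]; apply/andP; split; lra.
Qed.

Lemma approximable_affine Phi : approximable Phi -> affine_on (MS Y) Phi.
Proof.
move=> aPhi nu nu1 nu2 t nuY nu1Y nu2Y /andP[t0 t1] mix.
apply/eqP; rewrite -subr_eq0 -normr_le0; apply/ler_addgt0Pr => e e0; rewrite add0r.
have e20 : 0 < e / 2 by rewrite divr_gt0.
have [g lg gP] := aPhi _ e20.
have [D uD gD] := loc_const_finite cZ lg.
have gmix : \int[nu]_(y in setT) g y =
    t * \int[nu1]_(y in setT) g y + (1 - t) * \int[nu2]_(y in setT) g y.
  rewrite !(@Rintegral_loc_const R Z cZ _ g D lg uD gD) !mulr_sumr -big_split /=.
  apply: eq_bigr => r _.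
  have mr : measurable (g @^-1` [set r] : set (Borel Z)).
    by apply: measurable_clopen; exact: loc_const_clopen.
  rewrite mix// fineD ?fineM ?fin_numM ?fin_num_measure//=.
  ring.
have := gP _ nuY; have := gP _ nu1Y; have := gP _ nu2Y; rewrite gmix.
move: (\int[nu1]_(y in setT) g y) (\int[nu2]_(y in setT) g y) => a b.
rewrite !ler_norml => /andP[l1 l2] /andP[l3 l4] /andP[l5 l6].
have s0 : 0 <= 1 - t by rewrite subr_ge0.
have := ler_wpM2l t0 l3; have := ler_wpM2l t0 l4.
have := ler_wpM2l s0 l1; have := ler_wpM2l s0 l2.
move=> ? ? ? ?; apply/andP; split; lra.
Qed.

Lemma approximable_clopen (C : set Z) : clopen C ->
  approximable (fun nu => fine (nu C)).
Proof.
move=> cC e e0; exists (\1_C); first exact: loc_const_indic.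
by move=> nu _; rewrite (@Rintegral_indicT R Z nu C cC) subrr normr0 ltW.
Qed.

(** * Compactness of the set of invariant measures *)

Section ultralimits_of_measures.
Variable U : set_system nat.
Hypotheses (UF : UltraFilter U) (ooU : \oo `<=` U).

Definition ultralimit (nu_ : nat -> probability (Borel (Conf B)) R)
    (nu : probability (Borel (Conf B)) R) : Prop :=
  forall h : Z -> R, loc_const h ->
    \int[nu_ n]_(y in setT) h y @[n --> U] --> \int[nu]_(y in setT) h y.

(** For invariant [nu_ n] the empirical means are the plain integrals, so [krylov_bogolyubov]
    becomes a compactness statement. *)
Lemma MS_ultralimit (nu_ : nat -> probability (Borel (Conf B)) R) : (forall n, MS Y (nu_ n)) ->
  exists2 nu, MS Y nu & ultralimit nu_ nu.
Proof.
move=> nuY.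
have nuY1 n : nu_ n Y = 1%E by have [] := nuY n.
have [nu [nY inu lim]] := @krylov_bogolyubov R Z U (stone_conf R B) UF ooU shift Y nu_
  cshift clY shY nuY1.
exists nu => // h lh.
rewrite (_ : (fun n => _) = (fun n => empirical_mean (Z := Z) shift nu_ n h)).
  exact: lim.
apply/funext => n; rewrite /empirical_mean.
have [_ inun] := nuY n.
have hi i : \int[nu_ n]_(z in setT) h (iter i shift z) = \int[nu_ n]_(z in setT) h z.
  exact: (@Rintegral_invariant_iter R Z shift (nu_ n) i h cZ cshift inun lh).
rewrite (eq_bigr _ (fun (i : 'I_n.+1) _ => hi i)).
move: (\int[nu_ n]_(z in setT) h z) => c.
by rewrite sumr_const card_ord -[c *+ _]mulr_natl mulKf// pnatr_eq0.
Qed.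

(** Krylov-Bogolyubov averages of a Dirac mass at a point of [Y]. *)
Lemma MS_nonempty : exists nu : probability (Borel (Conf B)) R, MS Y nu.
Proof.
have [[y0 Yy0] _] := sY.
pose d : probability (Borel Z) R := dirac (y0 : Borel Z).
have dY (n : nat) : d Y = 1%E by rewrite /d /= diracE mem_set.
have [nu [nY inu _]] := @krylov_bogolyubov R Z U (stone_conf R B) UF ooU shift Y (fun=> d)
  cshift clY shY dY.
by exists nu.
Qed.

Lemma approximable_ultralimit Phi nu_ nu : approximable Phi ->
  (forall n, MS Y (nu_ n)) -> MS Y nu -> ultralimit nu_ nu ->
  Phi (nu_ n) @[n --> U] --> Phi nu.
Proof.
move=> aPhi nunY nuY lim; apply/cvgrPdist_lt => e e0.
have e30 : 0 < e / 3 by rewrite divr_gt0.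
have [g lg gP] := aPhi _ e30.
have /cvgrPdist_lt /(_ _ e30) := lim g lg; apply: filterS => n gn.
have := gP _ nuY; have := gP _ (nunY n); move: gn.
rewrite !ler_norml !ltr_norml.
move=> /andP[? ?] /andP[? ?] /andP[? ?]; apply/andP; split; lra.
Qed.

Lemma approximable_bounded Phi : approximable Phi ->
  exists M, forall nu, MS Y nu -> `|Phi nu| <= M.
Proof.
move=> aPhi; have [g lg gP] := aPhi 1 ltr01.
have [M gM] := loc_const_bounded cZ lg.
exists (1 + M) => nu nuY; rewrite -(subrK (\int[nu]_(y in setT) g y) (Phi nu)).
rewrite (le_trans (ler_normD _ _))// lerD// ?gP//.
exact: (@Rintegral_loc_const_norm R Z cZ nu g M lg gM).
Qed.

(** * Lexicographic maximization *)

Section lexicographic_faces.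
Variable Phi : nat -> probability (Borel (Conf B)) R -> R.
Hypothesis aPhi : forall k, approximable (Phi k).

(* The points surviving the successive maximizations of [Phi 0], ...,          *)
(* [Phi (k - 1)].                                                             *)
Fixpoint face k : set (probability (Borel (Conf B)) R) :=
  if k is k'.+1 then
    [set nu | face k' nu /\ forall nu', face k' nu' -> Phi k' nu' <= Phi k' nu]
  else MS Y.

Lemma face_le k l nu : (k <= l)%N -> face l nu -> face k nu.
Proof.
elim: l => [|l IH]; first by rewrite leqn0 => /eqP ->.
by rewrite leq_eqVlt => /predU1P[-> //|kl] [fl _]; exact: IH.
Qed.

Lemma face_MS k nu : face k nu -> MS Y nu.
Proof. exact: (@face_le 0). Qed.

(** Faces are closed. Membership is asked only eventually, to suit the diagonal sequence in
    [faces_nonempty]. *)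
Lemma face_ultralimit nu_ nu k : (forall n, MS Y (nu_ n)) -> MS Y nu ->
  ultralimit nu_ nu -> (\forall n \near U, face k (nu_ n)) -> face k nu.
Proof.
move=> nunY nuY lim; elim: k => [//|k IH] fk; split.
  by apply: IH; apply: filterS fk => n /= [].
move=> nu' fnu'.
have cv := approximable_ultralimit (aPhi k) nunY nuY lim.
by apply: (cvgr_to_ge cv); apply: filterS fk => n /= [_]; exact.
Qed.

Lemma face_nonempty k : exists nu, face k nu.
Proof.
elim: k => [|k [nu0 fnu0]]; first exact: MS_nonempty.
have [M PhiM] := approximable_bounded (aPhi k).
pose S := [set Phi k nu | nu in face k].
have supS : has_sup S.
  split; first by exists (Phi k nu0), nu0.
  exists M => _ [nu fnu <-]; have := PhiM _ (face_MS fnu).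
  by rewrite ler_norml => /andP[].
have /choice[nu_ nu_P] (n : nat) : exists nu, face k nu /\ sup S - n.+1%:R^-1 < Phi k nu.
  have [|_ [nu fnu <-] lt] := @sup_adherent _ S n.+1%:R^-1 _ supS; first by rewrite invr_gt0.
  by exists nu.
have nunY n : MS Y (nu_ n) by have [/face_MS] := nu_P n.
have [nu nuY lim] := MS_ultralimit nunY.
exists nu; split.
  by apply: (face_ultralimit nunY nuY lim); apply: nearW => n; have [] := nu_P n.
move=> nu' fnu'.
have cv := approximable_ultralimit (aPhi k) nunY nuY lim.
have c1 : sup S - 1 / n.+1%:R @[n --> U] --> sup S - 0.
  by apply: cvgB; [exact: cvg_cst|exact: ultra_invS].
apply: (@le_trans _ _ (sup S - 0)).
  by rewrite subr0; apply: ub_le_sup; [case: supS|exists nu'].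
apply: (ler_cvg_to c1 cv); apply: nearW => n.
by have [_ /ltW] := nu_P n; rewrite div1r.
Qed.

(** Cantor intersection: with [nu_ n] in the [n]-th face, an ultralimit lies in all of them, as the
    faces decrease. *)
Lemma faces_nonempty : exists nu, forall k, face k nu.
Proof.
have /choice[nu_ nu_P] := face_nonempty.
have nunY n : MS Y (nu_ n) by exact: face_MS (nu_P n).
have [nu nuY lim] := MS_ultralimit nunY.
exists nu => k; apply: (face_ultralimit nunY nuY lim).
by apply: ooU; exists k => // n /= kn; exact: face_le kn (nu_P n).
Qed.

(** An affine functional that is maximal at a proper mixture is maximal at both components. *)
Lemma face_mixture k nu nu1 nu2 (t : R) : face k nu -> MS Y nu1 -> MS Y nu2 ->
  0 < t < 1 -> mixture nu nu1 nu2 t -> face k nu1 /\ face k nu2.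
Proof.
move=> + nu1Y nu2Y /andP[t0 t1] mix; elim: k => [//|k IH] [fnu mnu].
have [f1 f2] := IH fnu.
have t01 : 0 <= t <= 1 by rewrite !ltW.
have aff := approximable_affine (aPhi k) (face_MS fnu) nu1Y nu2Y t01 mix.
have l1 := mnu _ f1; have l2 := mnu _ f2.
have s0 : 0 < 1 - t by rewrite subr_gt0.
have e1 : Phi k nu1 = Phi k nu.
  apply/eqP; rewrite eq_le l1 /= -(ler_pM2l t0).
  have := ler_wpM2l (ltW s0) l2; lra.
have e2 : Phi k nu2 = Phi k nu.
  apply/eqP; rewrite eq_le l2 /= -(ler_pM2l s0).
  have := ler_wpM2l (ltW t0) l1; lra.
by split; split => //; [rewrite e1|rewrite e2].
Qed.

End lexicographic_faces.
End ultralimits_of_measures.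

(** The components of a mixture equal to [nu] lie in every face with [nu], so they give the same
    mass to each clopen set and coincide. *)
Lemma approximable_extreme_max Psi : approximable Psi ->
  exists2 nu, extreme_point (MS Y) nu & forall nu', MS Y nu' -> Psi nu' <= Psi nu.
Proof.
move=> aPsi.
have [U [UF ooU]] := ultraFilterLemma (eventually_filter : ProperFilter (\oo : set_system nat)).
have [_ _ [e [ce eE]]] := stone_conf R B.
pose Phi k (nu : probability (Borel (Conf B)) R) :=
  if k is k'.+1 then fine (nu (e k')) else Psi nu.
have aPhi k : approximable (Phi k).
  by case: k => [//|k]; exact: approximable_clopen.
have [nu fnu] := faces_nonempty UF ooU aPhi.
exists nu; last by have [] := fnu 1%N.
split; first exact: fnu 0%N.
move=> nu1 nu2 t nu1Y nu2Y t01 mix E mE.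
apply: (@eq_probability R Z (stone_conf R B) nu1 nu2) => //; first exact: probability_setT.
move=> C /eE[k ->].
(* The mass of [e k] is [Phi k.+1], which is maximized on passing from [face k.+1] to [face k.+2];
   each component bounds the other. *)
have [[_ m1] [_ m2]] := face_mixture aPhi (fnu k.+2) nu1Y nu2Y t01 mix.
have [f1 f2] := face_mixture aPhi (fnu k.+1) nu1Y nu2Y t01 mix.
have mek : measurable (e k : set (Borel Z)) by exact: measurable_clopen.
have e12 : fine (nu1 (e k)) = fine (nu2 (e k)).
  by apply/eqP; rewrite eq_le (m1 _ f2) (m2 _ f1).
have e1 : (fine (nu1 (e k)))%:E = nu1 (e k) by rewrite fineK// fin_num_measure.
have e2 : (fine (nu2 (e k)))%:E = nu2 (e k) by rewrite fineK// fin_num_measure.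
by transitivity ((fine (nu1 (e k)))%:E); [exact: esym|rewrite e12].
Qed.

End approximable_functionals.

(** * Uniform approximation of [psi] *)

Section psi_approximable.
Variables (R : realType) (A B : pfinType) (X : set (Conf A)) (Y : set (Conf B)).
Hypotheses (sX : is_shift X) (tX : transitive_shift X) (sY : is_shift Y).
Variable f : Conf A * Conf B -> R.
Hypothesis cf : {within X `*` Y, continuous f}.

Let Z := conf2_ptop A B.
Let cZ : compact [set: Z]. Proof. exact: compact_conf2. Qed.

(** Replacing [f] by a locally constant [h] costs [e / 3] on either side, and the coupling of
    [coupling_exists] adds at most [C / n.+1] from above. Finiteness comes along because [psi] is
    defined by [fine]. *)
Lemma psi_approximation (e : R) : 0 < e ->
  exists2 g : conf_ptop B -> R, loc_const g &
    forall nu, MS Y nu -> psiE X Y f nu \is a fin_num /\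
      `|psi X Y f nu - \int[nu]_(y in setT) g y| <= e.
Proof.
move=> e0; have e30 : 0 < e / 3 by rewrite divr_gt0.
have clXY := closed_rectangle sX sY.
have cXY : compact (X `*` Y : set Z) := subclosed_compact clXY cZ (@subsetT _ _).
have [M [h [hM fh]]] :=
  @loc_const_approximation Z _ (agree2_resolution A B) R _ f _ cXY cf e30.
have lh : loc_const (Z := Z) h := @agree_loc_const Z _ (agree2_resolution A B) M _ h hM.
have [F hF] := loc_const_bounded cZ lh.
have [C [C0 gC]] := fiber_min_subadditive sX hM hF tX.
(* The block length is chosen to make the glueing cost per step at most [e / 3]. *)
have [n Cn] : exists n : nat, C <= n.+1%:R * (e / 3).
  exists (Num.bound (C / (e / 3))).
  rewrite -ler_pdivrMr//.
  have h0 : 0 <= C / (e / 3) by rewrite divr_ge0// ltW.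
  apply: le_trans (ltW (archi_boundP h0)) _.
  by rewrite ler_nat.
have n0 : 0 < n.+1%:R :> R by [].
have lg := fiber_min_loc_const X hM n.+1.
exists (fun y => n.+1%:R^-1 * fiber_min X h n.+1 y).
  exact: (loc_const_fun1 (fun r => n.+1%:R^-1 * r) lg).
move=> nu nuY; have [_ inu] := nuY.
have -> : \int[nu]_(y in setT) (n.+1%:R^-1 * fiber_min X h n.+1 y) =
    n.+1%:R^-1 * mean_fiber_min X h nu n.+1.
  rewrite RintegralZl//.
  exact: (@loc_const_integrable R (conf_ptop B) (@compact_conf B) nu _ lg).
set a := n.+1%:R^-1 * _.
have fl l : couplings X Y nu l -> (\int[l]_(z in X `*` Y) (f z)%:E)%E \is a fin_num /\
    `|\int[l]_(z in X `*` Y) f z - \int[l]_(z in setT) h z| <= e / 3.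
  move=> [lXY _].
  apply: (@Rintegral_approximation R Z _ (agree2_resolution A B) cZ _ l
    clXY lXY f h (e / 3) cf lh).
  by move=> z Kz; exact: ltW (fh z Kz).
have lower : ((a - e / 3)%:E <= psiE X Y f nu)%E.
  apply: le_ereal_inf_tmp => _ [l cl <-]; have [fin] := fl l cl.
  rewrite -(fineK fin) lee_fin -/(Rintegral _ _ _) ler_norml => /andP[lo _].
  have := coupling_mean_ge sX sY hM hF n.+1 cl; rewrite -ler_pdivrMl// -/a.
  lra.
have [l cl lC] := coupling_exists sX sY hM hF nuY gC.
have upper : (psiE X Y f nu <= (a + e / 3 + e / 3)%:E)%E.
  have [fin] := fl l cl => lf.
  apply: (@le_trans _ _ (\int[l]_(z in X `*` Y) (f z)%:E)%E).
    by apply: ereal_inf_lbound; exists l.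
  rewrite -(fineK fin) lee_fin -/(Rintegral _ _ _).
  have := lC n.+1; rewrite -ler_pdivlMl// mulrDr -/a.
  have : n.+1%:R^-1 * C <= e / 3 by rewrite ler_pdivrMl.
  move: (n.+1%:R^-1 * C) lf => c; rewrite ler_norml => /andP[_ up] ce hc.
  lra.
have fin : psiE X Y f nu \is a fin_num.
  by rewrite fin_numElt (lt_le_trans _ lower) ?ltNyr// (le_lt_trans upper) ?ltry.
have lo : a - e / 3 <= psi X Y f nu by rewrite -lee_fin /psi fineK.
have up : psi X Y f nu <= a + e / 3 + e / 3 by rewrite -lee_fin /psi fineK.
by split=> //; rewrite ler_norml; apply/andP; split; lra.
Qed.

End psi_approximable.

Theorem theorem3p9 (R : realType) (A B : pfinType)
  (X : set (Conf A)) (Y : set (Conf B)) :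
  is_SFT X -> transitive_shift X -> is_shift Y ->
  forall f : Conf A * Conf B -> R, {within X `*` Y, continuous f} ->
  [/\ (forall nu, MS Y nu -> psiE X Y f nu \is a fin_num),
      weak_star_continuous_on Y (MS Y) (psi X Y f),
      affine_on (MS Y) (psi X Y f) &
      exists nu0, extreme_point (MS Y) nu0 /\
        psiE X Y f nu0 = ereal_sup [set psiE X Y f nu | nu in MS Y]].
Proof.
move=> [sX _] tX sY f cf.
have apsi : approximable Y (psi X Y f).
  move=> e /(psi_approximation sX tX sY cf)[g lg gP].
  by exists g => // nu /gP[].
have fin nu : MS Y nu -> psiE X Y f nu \is a fin_num.
  by have [g _ gP] := psi_approximation sX tX sY cf (@ltr01 R); move=> /gP[].
split=> //; [exact: approximable_weak_star|exact: approximable_affine|].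
have [nu0 enu0 max0] := approximable_extreme_max sY apsi.
exists nu0; split=> //.
have nu0Y : MS Y nu0 by case: enu0.
apply/eqP; rewrite eq_le; apply/andP; split.
  by apply: ereal_sup_ubound; exists nu0.
apply: ge_ereal_sup => _ [nu nuY <-].
by rewrite -(fineK (fin _ nuY)) -(fineK (fin _ nu0Y)) lee_fin; exact: max0.
Qed.
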